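(* Let $G$ be a finite group and $p$ a prime. Then $$\chi(\mathscr{C}_p(G))=\begin{cases}1,&\text{if } G \text{ is a } p\text{-group};\\ -\sum_{H\in\mathcal{S}_p(G)\cup\{1\}}\mu(H,G)\,|G:H|,&\text{otherwise},\end{cases}$$ where $\mu$ is the Möbius function of the poset $\mathcal{S}_p(G)\cup\{1,G\}$ ordered by inclusion. Moreover, the following statements are equivalent: (1) $G$ is a $p$-group; (2) $\mathscr{C}_p(G)$ is contractible; (3) $\mathscr{C}_p(G)$ is $\mathbb{Z}$-acyclic; (4) $\chi(\mathscr{C}_p(G))=1$.
   Context: $\mathcal{S}_p(G)$ is the set of all non-trivial $p$-subgroups of $G$, and $1$ also denotes the trivial subgroup. $\mathscr{C}_p(G)=\{Hx\mid H\in\mathcal{S}_p(G)\cup\{1\},\ x\in G\}$ is the poset, ordered by inclusion, of all right cosets of $p$-subgroups of $G$ (including the trivial subgroup). For a finite poset $\mathcal{P}$, $\Delta\mathcal{P}$ is its order complex (simplices are finite chains), topological statements about $\mathcal{P}$ refer to the geometric realization $|\Delta\mathcal{P}|$, and $\chi(\mathcal{P})=\sum_{i\ge 0}(-1)^i\#\{\text{chains of } i+1 \text{ elements}\}$ is the (non-reduced) Euler characteristic of $\Delta\mathcal{P}$. $\mathbb{Z}$-acyclic means that all reduced integral homology groups vanish. The Möbius function $\mu$ of a finite poset is the integer-valued function on pairs $x\le y$ with $\sum_{x\le z\le y}\mu(x,z)=\delta(x,y)=\sum_{x\le z\le y}\mu(z,y)$, where $\delta(x,y)=1$ if $x=y$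 and $0$ if $x<y$. *)

(* Defs.v *)
From HB Require Import structures.
From mathcomp Require Import all_boot all_order all_algebra all_fingroup.
From mathcomp Require Import all_solvable.
From mathcomp Require Import all_classical all_reals all_analysis.

Set Implicit Arguments.
Unset Strict Implicit.
Unset Printing Implicit Defensive.

Import Order.TTheory GRing.Theory Num.Theory.
Import numFieldNormedType.Exports.

Local Open Scope ring_scope.

(** A finite poset is a finite subset [P] of a [finPOrderType] [T], with the
    induced order. *)
Section FinitePoset.
Context {disp : Order.disp_t} {T : finPOrderType disp}.
Implicit Types (P : {set T}) (x y z : T).

(** The empty chain is included: it is the simplex of dimension -1, used for
    reduced homology. *)
Definition order_complex P : {set {set T}} :=
  [set c : {set T} | (c \subset P) && [forall x in c, forall y in c, (x >=< y)%O]]%SET.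

Definition euler_char P : int :=
  \sum_(i < #|P|)
    (-1) ^+ i *+ #|[set c in order_complex P | #|c| == i.+1]%SET|.

(** Integral chains are coefficient functions on simplices; [n] counts vertices,
    so [simplicial_chain P n] is the chain group in dimension [n - 1], and
    dimension -1 is the augmentation. *)
Definition simplicial_chain P (n : nat) (u : {ffun {set T} -> int}) : Prop :=
  forall s : {set T}, u s != 0 -> (s \in order_complex P) && (#|s| == n).

(** Linear extension of
    [x_0 < ... < x_n |-> \sum_i (-1)^i (x_0 < .. omit x_i .. < x_n)]: the
    position of [x] in the chain [t] is the number of [y] in [t] below [x]. *)
Definition boundary (u : {ffun {set T} -> int}) : {ffun {set T} -> int} :=
  [ffun s : {set T} => \sum_(t : {set T}) \sum_(x in t | t :\ x == s)
     (-1) ^+ #|[set y in t | (y < x)%O]%SET| * u t].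

(** Vanishing of the reduced simplicial homology of the order complex in every
    dimension [n - 1 >= -1]: every cycle is a boundary. *)
Definition Z_acyclic P : Prop :=
  forall (n : nat) (u : {ffun {set T} -> int}),
    simplicial_chain P n u -> boundary u = 0 ->
    exists2 v, simplicial_chain P n.+1 v & boundary v = u.

(** Barycentric coordinates; [{ptws T -> R}] is the Euclidean space R^T. *)
Definition realization (R : realType) P : set {ptws T -> R} :=
  [set w : {ptws T -> R} |
     [/\ forall x, 0 <= w x,
         \sum_(x : T) w x = 1 &
         [set x | w x != 0]%SET \in order_complex P]]%classic.

Definition is_moebius P (mu : T -> T -> int) : Prop :=
  forall x y, x \in P -> y \in P -> (x <= y)%O ->
    \sum_(z in P | (x <= z <= y)%O) mu x z = (x == y)%:R /\
    \sum_(z in P | (x <= z <= y)%O) mu z y = (x == y)%:R.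

(** The fuel [n] only has to exceed the length of every chain of [P]. *)
Fixpoint moebius_rec P (n : nat) x y : int :=
  if n is m.+1 then
    if x == y then 1
    else - \sum_(z in P | (x <= z < y)%O) moebius_rec P m x z
  else 0.

Definition moebius P x y : int := moebius_rec P #|P|.+1 x y.

Lemma moebius_inverse_eq P (mu nu : T -> T -> int) x y :
  (forall a b, a \in P -> b \in P -> (a <= b)%O ->
     \sum_(z in P | (a <= z <= b)%O) mu a z = (a == b)%:R) ->
  (forall a b, a \in P -> b \in P -> (a <= b)%O ->
     \sum_(z in P | (a <= z <= b)%O) nu z b = (a == b)%:R) ->
  x \in P -> y \in P -> (x <= y)%O -> mu x y = nu x y.
Proof.
move=> hmu hnu xP yP xy.
have -> : mu x y = \sum_(z in P | (x <= z <= y)%O)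
    mu x z * \sum_(w in P | (z <= w <= y)%O) nu w y.
  rewrite (bigD1 y) ?yP ?xy ?lexx //= hnu // eqxx mulr1.
  rewrite big1 ?addr0 // => z /andP[/andP[zP /andP[xz zy]] zNy].
  by rewrite hnu // (negbTE zNy) mulr0.
have -> : nu x y = \sum_(w in P | (x <= w <= y)%O)
    (\sum_(z in P | (x <= z <= w)%O) mu x z) * nu w y.
  rewrite (bigD1 x) ?xP ?xy ?lexx //= hmu // eqxx mul1r.
  rewrite big1 ?addr0 // => z /andP[/andP[zP /andP[xz zy]] zNx].
  by rewrite hmu // eq_sym (negbTE zNx) mul0r.
under eq_bigr do rewrite mulr_sumr.
under [RHS]eq_bigr do rewrite mulr_suml.
rewrite (exchange_big_dep (fun w => (w \in P) && (x <= w <= y)%O)) /=; last first.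
  move=> z w /andP[zP /andP[xz zy]] /andP[-> /andP[zw ->]].
  by rewrite (le_trans xz zw).
apply: eq_bigr => w /andP[wP /andP[xw wy]]; apply: eq_bigl => z.
rewrite wP wy !andbT; case: (z \in P) => //=.
apply/idP/idP => [/andP[/andP[-> _] ->]//|/andP[-> zw]].
by rewrite zw (le_trans zw wy).
Qed.

Lemma moebius_rec_stable P n x y : x \in P ->
  (#|[set z in P | (x <= z < y)%O]%SET| < n)%N ->
  moebius_rec P n.+1 x y = moebius_rec P n x y.
Proof.
move=> xP; elim: n y => [//|n IHn] y hn.
rewrite [LHS]/= [RHS]/=; case: eqP => // _; congr (- _).
apply: eq_bigr => z /andP[zP /andP[xz zy]].
rewrite ltnS in hn; apply: IHn; apply: leq_trans hn.
apply: proper_card; apply/properP; split.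
  apply/fintype.subsetP => w; rewrite !inE => /andP[-> /andP[-> wz]] /=.
  exact: lt_trans zy.
by exists z; rewrite !inE zP xz ?zy ?ltxx.
Qed.

Lemma moebiusE P x y : x \in P -> moebius P x y =
  if x == y then 1 else - \sum_(z in P | (x <= z < y)%O) moebius P x z.
Proof.
move=> xP; rewrite {1}/moebius -moebius_rec_stable //.
by rewrite ltnS; apply: subset_leq_card; apply/fintype.subsetP => z; rewrite inE => /andP[].
Qed.

End FinitePoset.

Arguments realization {disp T} R P.

Section Moebius.
Context {disp : Order.disp_t} {T : finPOrderType disp}.
Implicit Types (P : {set T}) (x y z : T).

Lemma moebius_suml P x y : x \in P -> y \in P -> (x <= y)%O ->
  \sum_(z in P | (x <= z <= y)%O) moebius P x z = (x == y)%:R.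
Proof.
move=> xP yP xy; rewrite (bigD1 y) ?yP ?xy ?lexx //= moebiusE //.
rewrite [X in _ + X](eq_bigl (fun z => (z \in P) && (x <= z < y)%O)); last first.
  move=> z; rewrite lt_neqAle; case: (z \in P) => //=.
  by case: (x <= z)%O => //=; exact: andbC.
case: eqP => [<-|_]; last by rewrite addNr.
rewrite big1 ?addr0 // => z /andP[_ /andP[xz zx]].
by have := le_lt_trans xz zx; rewrite ltxx.
Qed.

End Moebius.

Lemma moebiusP (disp : Order.disp_t) (T : finPOrderType disp) (P : {set T}) :
  is_moebius P (moebius P).
Proof.
pose nu (x y : T) : int := @moebius _ T^d P y x.
have hnu a b : a \in P -> b \in P -> (a <= b)%O ->
    \sum_(z in P | (a <= z <= b)%O) nu z b = (a == b)%:R.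
  move=> aP bP ab; rewrite eq_sym -(@moebius_suml _ T^d P b a) //.
  by apply: eq_bigl => z; congr (_ && _); exact: andbC.
move=> x y xP yP xy; split; first exact: moebius_suml.
rewrite -(hnu x y) //; apply: eq_bigr => z /andP[zP /andP[_ zy]].
by apply: (@moebius_inverse_eq _ _ P) => // a b; exact: moebius_suml.
Qed.

Lemma moebius_uniq (disp : Order.disp_t) (T : finPOrderType disp) (P : {set T})
    (mu : T -> T -> int) (x y : T) :
  is_moebius P mu -> x \in P -> y \in P -> (x <= y)%O -> mu x y = moebius P x y.
Proof.
move=> hmu; apply: moebius_inverse_eq => a b aP bP ab.
  by case: (hmu a b aP bP ab).
by case: (moebiusP aP bP ab).
Qed.

(** A homotopy inside the subspace [X] from the identity to a constant map. *)
Definition contractible (R : realType) (V : topologicalType) (X : set V) : Prop :=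
  exists (x0 : V) (F : R * V -> V),
    [/\ X x0,
        ({within `[0, 1] `*` X, continuous F})%classic,
        forall t x, 0 <= t <= 1 -> X x -> X (F (t, x)),
        forall x, X x -> F (0, x) = x &
        forall x, X x -> F (1, x) = x0].

(** Orders [{set gT}] by inclusion. *)
Import Order.DefaultSetSubsetOrder.

Section Subgroups.
Context {gT : finGroupType}.
Implicit Types (p : nat) (G : {group gT}).

Definition nontrivial_p_subgroups p G : {set {group gT}} :=
  [set H : {group gT} | [&& H \subset G, (p.-group H)%g & H :!=: 1%g]]%SET.

Definition coset_poset p G : {set {set gT}} :=
  [set (H :* x)%g |
     H : {group gT} in (1%G |: nontrivial_p_subgroups p G)%SET, x : gT in G]%SET.

Definition subgroup_poset p G : {set {set gT}} :=
  [set (H : {set gT}) |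
     H : {group gT} in ([set 1%G; G] :|: nontrivial_p_subgroups p G)%SET]%SET.

End Subgroups.

(* Main.v *)
From HB Require Import structures.
Require Import Defs.
From mathcomp Require Import all_boot all_order all_algebra all_fingroup.
From mathcomp Require Import all_solvable.
From mathcomp Require Import all_classical all_reals all_analysis.

Set Implicit Arguments.
Unset Strict Implicit.
Unset Printing Implicit Defensive.

Import Order.TTheory GRing.Theory Num.Theory.
Import numFieldNormedType.Exports.
Import Order.DefaultSetSubsetOrder.
Local Open Scope ring_scope.

(** The four conditions are tied together by a cycle of implications.

    If [G] is a p-group it is itself the largest coset, and the realization of
    a poset with a largest element contracts linearly onto that vertex
    ([top_contractible]).

    A contractible realization is acyclic ([contractible_acyclic]), by
    simplicial approximation.  Let [F] be the contraction.  On chains of small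
    tuples of points of [0, 1] x |K|, the rule that sends [(t, x)] to a vertex
    with a large coordinate in [F (t, x)] is a chain map into the chains of
    [K], because uniform continuity makes the chosen vertices span a simplex.
    Iterated barycentric subdivision of the prisms over the simplices of [K]
    produces such small tuples.  At time 0 the composite is the identity, since
    it carries every simplex to itself ([carried_chain_map_id]); at time 1 it
    factors through one vertex.  The prism over a cycle is therefore a homology
    from the cycle to a cycle of a point ([discrete_homotopy]).
    Everything is done dually: a chain map out of tuples is a cochain with
    values in the target, so that subdivision and prism become operators on
    functions [seq X -> M], and no group of formal sums of points is needed.

    For an acyclic complex, rank-nullity over the rationals makes the
    alternating sum of the numbers of simplices telescope
    ([acyclic_euler_char]).

    If a prime [q] other than [p] divides the order of [G], an element of order
    [q] acts on the chains of the coset poset by right translation.  A fixed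
    chain would consist of fixed cosets, but a coset of a p-subgroup is
    stabilized by p-elements only.  Hence [q] divides the number of nonempty
    chains of each length, and the Euler characteristic cannot be 1
    ([euler_char_pgroup]).

    For the formula, sorting chains by their smallest element writes the Euler
    characteristic as the sum over the cosets [D] of a function determined by
    the strict up-sets of the poset ([euler_char_above],
    [altsum_above_rec]).  The cosets above [H x] correspond to the p-subgroups
    above [H], so that function satisfies the recursion of minus the
    Möbius function ([altsum_above_coset]); each [H] contributes [|G : H|]
    cosets. *)

(** * Coboundary and subdivision of cochains *)

Section Cochains.
Context {X : eqType} {M : zmodType}.
Implicit Types (c d : seq X -> M) (s t : seq X) (Q : M -> Prop).

(** The coboundary [sum_i (-1)^i c (s without its i-th entry)]; the recursion
    on the head makes the computations below inductions without indices. *)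
Fixpoint codiff c s : M :=
  if s is x :: t then c t - codiff (fun t => c (x :: t)) t else 0.

(** Every property of the values of a cochain that defines a subgroup passes
    to its coboundary; supports and vanishing are instances. *)
Lemma codiff_ind Q c s :
  Q 0 -> (forall a b, Q a -> Q b -> Q (a - b)) ->
  (forall t, (size t).+1 = size s -> {subset t <= s} -> Q (c t)) ->
  Q (codiff c s).
Proof.
move=> Q0 QB; elim: s c => [|x s IH] c Qc //=.
apply: QB; first by apply: Qc => // y ys; rewrite inE ys orbT.
apply: IH => t st ts; apply: Qc => [|y]; first by rewrite /= st.
by rewrite !inE => /orP[->|/ts->]; rewrite ?orbT.
Qed.

Lemma codiffB c d s : codiff (fun t => c t - d t) s = codiff c s - codiff d s.
Proof.
elim: s c d => [|x s IH] c d /=; first by rewrite subr0.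
by rewrite IH !opprD !opprK !addrA; congr (_ + _); rewrite addrAC.
Qed.

Lemma eq_codiff c d s :
  (forall t, (size t).+1 = size s -> {subset t <= s} -> c t = d t) ->
  codiff c s = codiff d s.
Proof.
move=> e; apply/eqP; rewrite -subr_eq0 -codiffB; apply/eqP.
apply: (codiff_ind (Q := fun a => a = 0)) => // [_ _ -> ->|t st ts].
  by rewrite subr0.
by rewrite e // subrr.
Qed.

Lemma codiffK c s : codiff (codiff c) s = 0.
Proof.
elim: s c => [|x s IH] c //=.
by rewrite codiffB IH subr0 subrr.
Qed.

End Cochains.

Lemma raddf_codiff (X : eqType) (M N : zmodType) (f : {additive M -> N})
    (c : seq X -> M) s : f (codiff c s) = codiff (fun t => f (c t)) s.
Proof. by elim: s c => [|x s IH] c /=; rewrite ?raddf0 // raddfB IH. Qed.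

Lemma codiff_map (X Y : eqType) (M : zmodType) (f : X -> Y) (c : seq Y -> M) s :
  codiff c (map f s) = codiff (fun t => c (map f t)) s.
Proof. by elim: s c => [|x s IH] c //=; rewrite IH. Qed.

Lemma size_ind (X : Type) (P : seq X -> Prop) :
  P [::] ->
  (forall s, (0 < size s)%N -> (forall t, (size t).+1 = size s -> P t) -> P s) ->
  forall s, P s.
Proof.
move=> P0 PS s; move: {2}(size s) (erefl (size s)) => n.
elim: n s => [|n IH] s es; first by move/size0nil: es => ->.
by apply: PS => [|t]; rewrite es // => -[/IH].
Qed.

(** For a simplex [s], barycentric subdivision is the cone from the barycenter
    [b s] over the subdivided boundary.  [subdiv] is the transpose of that
    operator; [b] may be any choice of a point for each sequence. *)
Section Subdivision.
Context {X : eqType} (b : seq X -> X).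

Fixpoint subdiv_rec (M : zmodType) n (c : seq X -> M) s : M :=
  if n is m.+1 then codiff (subdiv_rec m (fun t => c (b s :: t))) s else c [::].

Definition subdiv (M : zmodType) (c : seq X -> M) s := subdiv_rec (size s) c s.

Lemma subdiv_nil (M : zmodType) (c : seq X -> M) : subdiv c [::] = c [::].
Proof. by []. Qed.

Lemma subdivE (M : zmodType) (c : seq X -> M) s : (0 < size s)%N ->
  subdiv c s = codiff (subdiv (fun t => c (b s :: t))) s.
Proof.
case: s => // x s _; rewrite /subdiv [size _]/= [LHS]/subdiv_rec.
by apply: eq_codiff => t [<-] _.
Qed.

Lemma subdivB (M : zmodType) (c d : seq X -> M) s :
  subdiv (fun t => c t - d t) s = subdiv c s - subdiv d s.
Proof.
elim/size_ind: s c d => [|s s0 IH] c d; first by rewrite !subdiv_nil.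
by rewrite !subdivE // -codiffB; apply: eq_codiff => t st _; rewrite IH.
Qed.

Lemma raddf_subdiv (M N : zmodType) (f : {additive M -> N}) (c : seq X -> M) s :
  f (subdiv c s) = subdiv (fun t => f (c t)) s.
Proof.
elim/size_ind: s c => [|s s0 IH] c; first by rewrite !subdiv_nil.
by rewrite !subdivE // raddf_codiff; apply: eq_codiff => t st _; rewrite IH.
Qed.

Lemma eq_subdiv (M : zmodType) (c d : seq X -> M) : c =1 d -> subdiv c =1 subdiv d.
Proof.
move=> e s; elim/size_ind: s c d e => [|s s0 IH] c d e; first by rewrite !subdiv_nil.
by rewrite !subdivE //; apply: eq_codiff => t st _; apply: IH.
Qed.

(** Coning is a homotopy from the identity to 0, that is
    [codiff c (b s :: t) = c t - codiff (c o cons (b s)) t], so the coboundary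
    of the cone term cancels by induction and [codiffK]. *)
Lemma subdiv_codiff (M : zmodType) (c : seq X -> M) s :
  subdiv (codiff c) s = codiff (subdiv c) s.
Proof.
elim/size_ind: s c => [|s s0 IH] c //.
rewrite subdivE //.
transitivity (codiff (fun t => subdiv c t - codiff (subdiv (fun t => c (b s :: t))) t) s).
  by apply: eq_codiff => t st _; rewrite /= subdivB IH.
by rewrite codiffB codiffK subr0.
Qed.

Lemma iter_subdiv_codiff (M : zmodType) m (c : seq X -> M) s :
  iter m (@subdiv M) (codiff c) s = codiff (iter m (@subdiv M) c) s.
Proof.
elim: m s => [//|m IH] s; rewrite !iterS -subdiv_codiff; exact: eq_subdiv.
Qed.

Lemma raddf_iter_subdiv (M N : zmodType) (f : {additive M -> N}) m (c : seq X -> M) s :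
  f (iter m (@subdiv M) c s) = iter m (@subdiv N) (fun t => f (c t)) s.
Proof. by elim: m s => [//|m IH] s; rewrite !iterS raddf_subdiv; apply: eq_subdiv. Qed.

Lemma eq_iter_subdiv (M : zmodType) m (c d : seq X -> M) :
  c =1 d -> iter m (@subdiv M) c =1 iter m (@subdiv M) d.
Proof. by move=> e; elim: m => // m IH; rewrite !iterS; apply: eq_subdiv. Qed.

End Subdivision.

(** * The prism operator *)

Section Prism.
Context {X Y : eqType} {M : zmodType} (a b : X -> Y).
Implicit Types (c : seq Y -> M) (s : seq X).

(** Transpose of the triangulation of a prism:
    [sum_i (-1)^i c (a x_0, .., a x_i, b x_i, .., b x_n)]. *)
Fixpoint prism c s : M :=
  if s is x :: t then
    c [:: a x, b x & map b t] - prism (fun t => c (a x :: t)) t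
  else 0.

Lemma prismB c d s : prism (fun t => c t - d t) s = prism c s - prism d s.
Proof.
elim: s c d => [|x s IH] c d /=; first by rewrite subr0.
by rewrite IH !opprD !opprK !addrA; congr (_ + _); rewrite addrAC.
Qed.

Lemma prism_ind (Q : M -> Prop) c s :
  Q 0 -> (forall u v, Q u -> Q v -> Q (u - v)) ->
  (forall t, size t = (size s).+1 ->
     {subset t <= map a s ++ map b s} -> Q (c t)) ->
  Q (prism c s).
Proof.
move=> Q0 QB; elim: s c => [|x s IH] c Qc //=.
apply: QB.
  apply: Qc => [|y]; first by rewrite /= size_map.
  by rewrite /= !(inE, mem_cat) => /or3P[] ->; rewrite ?orbT.
apply: IH => t st ts; apply: Qc => [|y]; first by rewrite /= st.
rewrite /= !(inE, mem_cat) => /predU1P[->|/ts]; first by rewrite eqxx.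
by rewrite mem_cat => /orP[] ->; rewrite ?orbT.
Qed.

Lemma codiff_prism c s :
  codiff (prism c) s + prism (codiff c) s = c (map b s) - c (map a s).
Proof.
elim: s c => [|x s IH] c /=; first by rewrite addr0 subrr.
rewrite codiffB prismB codiff_map.
have {IH} := IH (fun t => c (a x :: t)); rewrite /=.
set A := codiff _ s; set B := prism _ s; set p := prism c s; set q := codiff _ s.
set u := c (a x :: map b s) => e.
rewrite -[c (a x :: map a s)](subKr u) -e !opprB.
by rewrite [LHS](AC ((1*2)*((1*2)*2)) ((1*8)*(3*5)*(4*((2*7)*6)))) /= subrr addNr !add0r.
Qed.

End Prism.

Lemma eq_prism (X Y : eqType) (a b : X -> Y) (M : zmodType) (c d : seq Y -> M) :
  c =1 d -> prism a b c =1 prism a b d.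
Proof.
move=> + s; elim: s c d => [|x s IH] c d e //=.
by rewrite e; congr (_ - _); apply: IH.
Qed.

Lemma raddf_prism (X Y : eqType) (a b : X -> Y) (M N : zmodType)
    (f : {additive M -> N}) (c : seq Y -> M) s :
  f (prism a b c s) = prism a b (fun t => f (c t)) s.
Proof. by elim: s c => [|x s IH] c /=; rewrite ?raddf0 // raddfB IH. Qed.

(** * Mesh of the barycentric subdivision *)

Section Mesh.
Context {R : realFieldType} {I : Type}.
Implicit Types (s t : seq (I -> R)) (D : (I -> R) -> Prop).

Definition bary s : I -> R := fun i => (\sum_(y <- s) y i) / (size s)%:R.

Definition bary_closed D :=
  forall s, (0 < size s)%N -> {in s, forall y, D y} -> D (bary s).

Definition mesh_le (d : R) s := {in s &, forall x y, forall i, `|x i - y i| <= d}.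

Lemma bary_ge s i c : (0 < size s)%N -> {in s, forall y, c <= y i} -> c <= bary s i.
Proof.
move=> s0 sc; rewrite ler_pdivlMr ?ltr0n // mulr_natr -iter_addr_0.
by rewrite -count_predT -big_const_seq big_seq [leRHS]big_seq; apply: ler_sum.
Qed.

Lemma bary_le s i c : (0 < size s)%N -> {in s, forall y, y i <= c} -> bary s i <= c.
Proof.
move=> s0 sc; rewrite ler_pdivrMr ?ltr0n // mulr_natr -iter_addr_0.
by rewrite -count_predT -big_const_seq big_seq [leRHS]big_seq; apply: ler_sum.
Qed.

Lemma bary_eq s i c : (0 < size s)%N -> {in s, forall y, y i = c} -> bary s i = c.
Proof.
move=> s0 sc; apply/le_anti/andP; split.
  by apply: bary_le => // y /sc->.
by apply: bary_ge => // y /sc->.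
Qed.

(** In the average of the differences [x - y] over [s], the term [y = x]
    vanishes, which leaves the fraction [(size s - 1) / size s] of [d]. *)
Lemma dist_bary N d s x i : (0 < size s <= N)%N -> mesh_le d s -> x \in s -> 0 <= d ->
  `|x i - bary s i| <= (1 - N%:R^-1) * d.
Proof.
move=> /andP[s0 sN] sm xs d0.
have s0' : (size s)%:R != 0 :> R by rewrite pnatr_eq0 -lt0n.
have -> : x i - bary s i = (\sum_(y <- s) (x i - y i)) / (size s)%:R.
  rewrite sumrB mulrBl big_const_seq count_predT iter_addr addr0.
  by rewrite -(mulr_natr (x i)) mulfK.
rewrite normrM normfV normr_nat ler_pdivrMr ?ltr0n //.
rewrite (big_rem x) //= subrr add0r.
apply: (le_trans (ler_norm_sum _ _ _)).
apply: (@le_trans _ _ (\sum_(y <- rem x s) d)).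
  by rewrite big_seq [leRHS]big_seq; apply: ler_sum => y /mem_rem ys; apply: sm.
rewrite big_const_seq count_predT iter_addr addr0 size_rem // -(mulr_natl d).
rewrite [leRHS]mulrAC; apply: ler_wpM2r => //.
rewrite mulrBl mul1r -subn1 natrB // lerD2l lerNl opprK.
by rewrite mulrC ler_pdivrMr ?ltr0n ?(leq_trans s0) // mul1r ler_nat.
Qed.

Lemma dist_bary_closed (z : I -> R) r : bary_closed (fun y => forall i, `|y i - z i| <= r).
Proof.
move=> s s0 sr i.
have s0' : (size s)%:R != 0 :> R by rewrite pnatr_eq0 -lt0n.
have -> : bary s i - z i = (\sum_(y <- s) (y i - z i)) / (size s)%:R.
  rewrite sumrB mulrBl big_const_seq count_predT iter_addr addr0.
  by rewrite -(mulr_natr (z i)) mulfK.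
rewrite normrM normfV normr_nat ler_pdivrMr ?ltr0n //.
apply: (le_trans (ler_norm_sum _ _ _)).
apply: (@le_trans _ _ (\sum_(y <- s) r)).
  by rewrite big_seq [leRHS]big_seq; apply: ler_sum => y ys; apply: sr.
by rewrite big_const_seq count_predT iter_addr addr0 -(mulr_natr r).
Qed.

Section Ind.
Context {M : zmodType} (Q : M -> Prop).
Hypotheses (Q0 : Q 0) (QB : forall a b, Q a -> Q b -> Q (a - b)).

(** Subdividing a sequence of at most [N] points shrinks its mesh by the factor
    [1 - 1/N] and does not leave a set closed under barycenters.  The induction
    on faces strengthens [D] by closeness to the barycenter of the whole
    sequence, which is what makes the new vertex close to all the others. *)
Lemma subdiv_ind D N (d : R) (c : seq (I -> R) -> M) s :
  bary_closed D -> (size s <= N)%N -> 0 <= d -> mesh_le d s -> {in s, forall y, D y} ->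
  (forall t, size t = size s -> {in t, forall y, D y} ->
     mesh_le ((1 - N%:R^-1) * d) t -> Q (c t)) ->
  Q (subdiv bary c s).
Proof.
move=> + + d0.
elim/size_ind: s c D => [|s s0 IH] c D bD sN sm sD Qc; first by rewrite subdiv_nil; apply: Qc.
rewrite subdivE //; apply: codiff_ind => // t' st ts.
have N0 : (0 < N)%N := leq_trans s0 sN.
pose D' y := D y /\ forall i, `|y i - bary s i| <= (1 - N%:R^-1) * d.
have kd0 : 0 <= (1 - N%:R^-1) * d.
  by rewrite mulr_ge0 // subr_ge0 invf_le1 ?ltr0n // ler1n.
apply: (IH t' st _ D').
- move=> r r0 rD; split; first by apply: bD => // y /rD[].
  by apply: dist_bary_closed => // y /rD[].
- by rewrite (leq_trans _ sN) // -st.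
- by move=> x y /ts xs /ts ys; apply: sm.
- move=> y /ts ys; split; first exact: sD.
  by move=> i; apply: dist_bary; rewrite ?s0.
move=> t tt tD tm; apply: Qc; first by rewrite /= tt.
  by move=> y; rewrite inE => /predU1P[->|/tD[]//]; apply: bD.
move=> x y; rewrite !inE => /predU1P[->|xt] /predU1P[->|yt] i.
- by rewrite subrr normr0.
- by rewrite distrC; have [_] := tD _ yt.
- by have [_] := tD _ xt.
- exact: tm.
Qed.

Lemma iter_subdiv_ind m D N (d : R) (c : seq (I -> R) -> M) s :
  bary_closed D -> (size s <= N)%N -> 0 <= d -> mesh_le d s -> {in s, forall y, D y} ->
  (forall t, size t = size s -> {in t, forall y, D y} ->
     mesh_le ((1 - N%:R^-1) ^+ m * d) t -> Q (c t)) ->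
  Q (iter m (@subdiv _ bary M) c s).
Proof.
elim: m s d => [|m IH] s d bD sN d0 sm sD Qc.
  by apply: Qc; rewrite ?expr0 ?mul1r.
rewrite iterS; apply: (subdiv_ind (D := D) (N := N) (d := d)) => // t ts tD tm.
(* For [N = 0] the ratio is meaningless, but only the empty sequence occurs. *)
have [N0|N0] := posnP N.
  have s0 : size s = 0%N by apply/eqP; rewrite -leqn0 -N0.
  have -> : t = [::] by apply: size0nil; rewrite ts.
  by apply: (IH _ d); rewrite ?s0 // => u u0 uD um; apply: Qc; rewrite ?u0 // (size0nil u0).
apply: (IH _ ((1 - N%:R^-1) * d)) => //; rewrite ?ts //.
  by rewrite mulr_ge0 // subr_ge0 invf_le1 ?ltr0n // ler1n.
by move=> u us uD; rewrite mulrA -exprSr => um; apply: Qc.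
Qed.

End Ind.
End Mesh.

(** * Simplicial chains on an ordered vertex set *)

Section Chains.
Context {T : finType} (rk : T -> nat).
Hypothesis rk_inj : injective rk.
Notation A := {ffun {set T} -> int}.
Implicit Types (u v : A) (s t : {set T}) (x y : T).

Definition sg x s : int := (-1) ^+ #|[set y in s | (rk y < rk x)%N]|.

Definition delta s : A := [ffun t : {set T} => (t == s)%:R].

(** The boundary, written by the coefficient at [s]: it collects the simplices
    [x |: s] that have [s] as a facet. *)
Definition bd u : A := [ffun s : {set T} => \sum_(x | x \notin s) sg x s * u (x |: s)].

(** Left exterior multiplication by the vertex [x], that is the oriented cone
    with apex [x]; it kills the simplices that contain [x]. *)
Definition wedge x u : A := [ffun s : {set T} => if x \in s then sg x s * u (s :\ x) else 0].

Lemma ffunMzE (u : A) k s : (u *~ k) s = u s *~ k.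
Proof. by case: k => n; rewrite ?NegzE ?mulrNz ?ffunE ffunMnE. Qed.

Lemma sg_sqr x s : sg x s * sg x s = 1.
Proof. by rewrite -expr2 sqrr_sign. Qed.

Lemma sg_setU1 x y s : y \notin s ->
  sg x (y |: s) = (-1) ^+ (rk y < rk x)%N * sg x s.
Proof.
move=> ys; rewrite /sg -exprD; congr (_ ^+ _).
rewrite (cardsD1 y) !inE eqxx /=; congr (_ + _)%N; apply: eq_card => z.
by rewrite !inE; case: eqVneq => [->|]; rewrite ?(negbTE ys).
Qed.

Lemma bd_is_zmod : zmod_morphism bd.
Proof.
move=> u v; apply/ffunP => s; rewrite !ffunE -sumrB; apply: eq_bigr => x _.
by rewrite !ffunE mulrBr.
Qed.
HB.instance Definition _ := GRing.isZmodMorphism.Build A A bd bd_is_zmod.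

Lemma wedge_is_zmod x : zmod_morphism (wedge x).
Proof.
move=> u v; apply/ffunP => s; rewrite !ffunE.
by case: ifP => _; rewrite ?subr0 // -mulrBr.
Qed.
HB.instance Definition _ x := GRing.isZmodMorphism.Build A A (wedge x) (wedge_is_zmod x).

(** The Clifford relation between contraction and exterior multiplication.  For
    [x] in [s] the terms at [y <> x] cancel in pairs, because exactly one of
    [x] and [y] precedes the other. *)
Lemma bd_wedge x u : bd (wedge x u) = u - wedge x (bd u).
Proof.
apply/ffunP => s; rewrite !ffunE; have [xs|xs] := ifPn.
  rewrite [in RHS](bigD1 x) ?finset.setD11 //=.
  rewrite finset.setD1K // mulrDr mulrA.
  have e : sg x s = sg x (s :\ x).
    by rewrite -{1}(finset.setD1K xs) sg_setU1 ?finset.setD11 // ltnn mul1r.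
  rewrite -e sg_sqr mul1r opprD addrA subrr add0r mulr_sumr -sumrN.
  have P y : (y \notin s :\ x) && (y != x) = (y \notin s).
    by rewrite !inE; case: eqVneq => [->|]; rewrite ?xs ?andbT.
  rewrite [RHS](eq_bigl _ _ P); apply: eq_bigr => y ys.
  rewrite ffunE !inE xs orbT.
  have nyx : y != x by apply: contraNneq ys => ->.
  have -> : (y |: s) :\ x = y |: (s :\ x).
    by apply/setP => z; rewrite !inE; case: eqVneq => // ->; rewrite eq_sym (negbTE nyx).
  rewrite !mulrA -mulNr; congr (_ * _).
  rewrite sg_setU1 // -{1}(finset.setD1K xs) sg_setU1 ?finset.setD11 //.
  have : rk y != rk x by apply: contra nyx => /eqP/rk_inj->.
  case: ltngtP => // _ _; rewrite ?expr0 ?expr1 ?mul1r !mulN1r ?mulNr ?mulrN ?mul1r //.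
    by rewrite mulrC.
  by rewrite mulrC.
rewrite subr0 (bigD1 x) //= ffunE finset.setU11 finset.setU1K // big1 ?addr0.
  by rewrite mulrA sg_setU1 // ltnn mul1r sg_sqr mul1r.
move=> y /andP[ys yx]; rewrite ffunE !inE eq_sym (negbTE yx) (negbTE xs) mulr0 //.
Qed.

(** The oriented simplex on an ordered list, with any order of the vertices; it
    is 0 when a vertex is repeated. *)
Definition simplex (l : seq T) : A := foldr wedge (delta finset.set0) l.

Lemma bd_delta0 : bd (delta finset.set0) = 0.
Proof.
apply/ffunP => s; rewrite !ffunE big1 // => x _; rewrite ffunE.
by case: eqP => [/setP/(_ x)|_]; rewrite ?mulr0 // !inE eqxx.
Qed.

Lemma bd_simplex l : bd (simplex l) = codiff simplex l.
Proof.
elim: l => [|x l IH] /=; first exact: bd_delta0.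
by rewrite bd_wedge IH raddf_codiff.
Qed.

Lemma simplex_supp l s : simplex l s != 0 -> s = [set x in l] /\ #|s| = size l.
Proof.
elim: l s => [|x l IH] s /=; rewrite ffunE.
  case: (s =P finset.set0) => [-> _|_]; last by rewrite eqxx.
  by rewrite cards0; split => //; apply/setP => y; rewrite !inE.
case: ifP => [xs|]; rewrite ?eqxx // mulf_eq0 negb_or => /andP[_ /IH[e c]].
rewrite -(finset.setD1K xs) e; split; first by apply/setP => y; rewrite !inE.
by rewrite -e cardsU1 finset.setD11 c.
Qed.

Definition srt s : seq T := [seq x <- sort (relpre rk leq) (enum T) | x \in s].

Lemma mem_srt s x : (x \in srt s) = (x \in s).
Proof. by rewrite mem_filter mem_sort mem_enum andbT. Qed.

Lemma srt_sorted s : sorted (relpre rk ltn) (srt s).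
Proof.
apply: sorted_filter; first by move=> y x z; apply: ltn_trans.
set l := sort _ _.
have : sorted (relpre rk leq) l by apply: sort_sorted => x y; apply: leq_total.
have : uniq l by rewrite sort_uniq enum_uniq.
rewrite -!sorted_map => ul sl; rewrite ltn_sorted_uniq_leq sl.
by rewrite map_inj_uniq // ul.
Qed.

Lemma srt_uniq s : uniq (srt s).
Proof. by rewrite filter_uniq // sort_uniq enum_uniq. Qed.

Lemma size_srt s : size (srt s) = #|s|.
Proof.
by rewrite -(card_uniqP (srt_uniq s)); apply: eq_card => x; rewrite mem_srt.
Qed.

Lemma srtD1 s x : srt (s :\ x) = [seq y <- srt s | y != x].
Proof.
by rewrite /srt -filter_predI; apply: eq_filter => y; rewrite !inE.
Qed.

(** In a list sorted by rank, the position of [x] is the number of entries of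
    smaller rank, so the sign of a face in [codiff] is the one in [bd]. *)
Lemma codiff_sorted (M : zmodType) (c : seq T -> M) l :
  sorted (relpre rk ltn) l ->
  codiff c l = \sum_(x <- l) c [seq y <- l | y != x] *~ sg x [set y in l].
Proof.
elim: l c => [|x l IH] c /=; first by rewrite big_nil.
move=> xl; have lt_x : {in l, forall y, (rk x < rk y)%N}.
  move: xl; rewrite path_sortedE; last by move=> y z w; apply: ltn_trans.
  by case/andP => /allP.
have xNl : x \notin l by apply/negP => /lt_x; rewrite ltnn.
rewrite big_cons eqxx /=; congr (_ + _).
  rewrite (_ : [seq _ <- _ | _] = l); last first.
    by apply/all_filterP/allP => y yl; apply: contraNneq xNl => <-.
  rewrite /sg (_ : [set _ in _ | _] = finset.set0) ?cards0 ?expr0 ?mulr1z //.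
  apply/setP => y; rewrite !inE; apply/negP => /andP[/predU1P[->|/lt_x h]].
    by rewrite ltnn.
  by rewrite ltnNge ltnW.
rewrite IH; last exact: path_sorted xl.
rewrite -sumrN big_seq [RHS]big_seq; apply: eq_bigr => y yl.
have nxy : x != y by apply: contraNneq xNl => ->.
rewrite nxy -mulrNz; congr (_ *~ _).
have -> : [set z in x :: l] = x |: [set z in l] by apply/setP => z; rewrite !inE.
by rewrite sg_setU1 ?inE // lt_x // expr1 mulN1r.
Qed.

Lemma codiff_srt (M : zmodType) (c : seq T -> M) s :
  codiff c (srt s) = \sum_(x in s) c (srt (s :\ x)) *~ sg x s.
Proof.
rewrite codiff_sorted ?srt_sorted //.
rewrite -[RHS]big_enum /=; under [RHS]eq_bigr do rewrite srtD1.
have -> : [set y in srt s] = s by apply/setP => y; rewrite inE mem_srt.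
apply: perm_big; apply: uniq_perm; rewrite ?srt_uniq ?enum_uniq // => y.
by rewrite mem_srt mem_enum.
Qed.

Section Lin.
Variable M : zmodType.
Implicit Types (c d : seq T -> M).

(** Evaluation of a cochain on a chain, each simplex being listed in increasing
    order. *)
Definition lin c u : M := \sum_s c (srt s) *~ u s.

Lemma lin_bd c u : lin c (bd u) = lin (codiff c) u.
Proof.
rewrite /lin.
under eq_bigr do rewrite ffunE mulrz_sumr.
under [RHS]eq_bigr do rewrite codiff_srt mulrz_suml.
rewrite (exchange_big_dep predT) //= [RHS](exchange_big_dep predT) //=.
apply: eq_bigr => x _.
rewrite (reindex_onto (fun s => s :\ x) (fun s => x |: s)) /=; last first.
  by move=> s xs; rewrite finset.setU1K.
rewrite (eq_bigl (fun s => x \in s)) => [|s]; last first.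
  rewrite finset.setD11 /=; apply/eqP/idP => [<-|]; first by rewrite finset.setU11.
  by apply: finset.setD1K.
apply: eq_bigr => s xs; rewrite finset.setD1K // -mulrzA; congr (_ *~ (_ * _)).
by rewrite -[in RHS](finset.setD1K xs) sg_setU1 ?finset.setD11 // ltnn mul1r.
Qed.

End Lin.

(** A chain map that carries every simplex into itself is the identity: it
    multiplies [delta s] by an integer, and comparing the coefficients of one
    facet in the boundary shows, by induction, that this integer is 1. *)
Lemma carried_chain_map_id (c : seq T -> A) (K : {set {set T}}) :
  (forall s x, s \in K -> s :\ x \in K) ->
  c [::] = delta finset.set0 ->
  (forall s, s \in K -> bd (c (srt s)) = codiff c (srt s)) ->
  (forall s, s \in K -> forall t, c (srt s) t != 0 -> t \subset s /\ #|t| = #|s|) ->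
  forall s, s \in K -> c (srt s) = delta s.
Proof.
move=> KD c0 cbd csupp s; move: {2}#|s| (erefl #|s|) => n.
elim: n s => [|n IH] s ns sK.
  have e : srt s = [::] by apply: size0nil; rewrite size_srt.
  by rewrite e c0 (cards0_eq ns).
have [x xs] : exists x, x \in s by apply/card_gt0P; rewrite ns.
have E t : c (srt s) t = c (srt s) s * (t == s)%:R.
  case: eqVneq => [->|ts]; rewrite ?mulr1 // mulr0.
  apply: contraNeq ts => /(csupp _ sK)[ts st].
  by rewrite eqEcard ts st leqnn.
have sx : sg x (s :\ x) != 0.
  by apply: contra_eqN (sg_sqr x (s :\ x)) => /eqP->; rewrite mulr0.
suff c1 : c (srt s) s = 1 by apply/ffunP => t; rewrite E c1 mul1r ffunE.
have /ffunP/(_ (s :\ x)) := cbd s sK.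
rewrite codiff_srt (eq_bigr (fun y => delta (s :\ y) *~ sg y s)); last first.
  move=> y ys; rewrite IH ?KD //.
  by have := cardsD1 y s; rewrite ys ns add1n => -[].
rewrite sum_ffunE ffunE (bigD1 x) ?finset.setD11 //= finset.setD1K // [X in _ + X]big1; last first.
  move=> y /andP[yn yx]; rewrite E; case: eqP; rewrite ?mulr0 //.
  move/setP/(_ x); rewrite !inE eqxx xs eq_sym (negbTE yx) //.
rewrite addr0 (bigD1 x) //= [X in _ + X]big1 => [|y /andP[ys yx]]; last first.
  rewrite ffunMzE ffunE; case: eqP; rewrite ?mul0rz //.
  by move/setP/(_ x); rewrite !inE eqxx xs eq_sym yx.
rewrite addr0 ffunMzE ffunE eqxx -[in RHS](finset.setD1K xs).
rewrite sg_setU1 ?finset.setD11 // ltnn mul1r intz -[RHS]mulr1.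
exact: mulfI.
Qed.

Lemma lin_raddf (M N : zmodType) (f : {additive M -> N}) (c : seq T -> M) u :
  f (lin c u) = lin (fun l => f (c l)) u.
Proof. by rewrite raddf_sum; apply: eq_bigr => s _; rewrite raddfMz. Qed.

Lemma linB (M : zmodType) (c d : seq T -> M) u :
  lin (fun l => c l - d l) u = lin c u - lin d u.
Proof. by rewrite -sumrB; apply: eq_bigr => s _; rewrite mulrzBl. Qed.

Lemma eq_lin (M : zmodType) (c d : seq T -> M) u :
  (forall s, u s != 0 -> c (srt s) = d (srt s)) -> lin c u = lin d u.
Proof.
move=> e; apply: eq_bigr => s _.
by have [->|/e->//] := eqVneq (u s) 0; rewrite !mulr0z.
Qed.

Lemma lin_delta u : lin (fun l => delta [set x in l]) u = u.
Proof.
apply/ffunP => s; rewrite sum_ffunE (bigD1 s) //= big1 => [|t ts].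
  rewrite addr0 ffunMzE ffunE (_ : [set _ in _] = s) ?eqxx ?intz //.
  by apply/setP => x; rewrite inE mem_srt.
rewrite ffunMzE ffunE (_ : [set _ in _] = t) 1?eq_sym ?(negbTE ts) ?mul0rz //.
by apply/setP => x; rewrite inE mem_srt.
Qed.

Lemma simplex_srt s : simplex (srt s) = delta s.
Proof.
apply: (carried_chain_map_id (K := [set: {set T}]%SET)).
- by move=> r x _; rewrite inE.
- by [].
- by move=> r _; exact: bd_simplex.
- move=> r _ t /simplex_supp[-> c]; split; last by rewrite c size_srt.
  by apply/fintype.subsetP => x; rewrite inE mem_srt.
- by rewrite inE.
Qed.

(** Both boundaries become coboundaries of the tautological cochain [simplex],
    so this follows from [codiffK]. *)
Lemma bdK u : bd (bd u) = 0.
Proof.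
have linS v : v = lin simplex v.
  rewrite -[LHS]lin_delta; apply: eq_lin => s _.
  by rewrite simplex_srt; congr delta; apply/setP => x; rewrite inE mem_srt.
rewrite [LHS]linS !lin_bd /lin big1 // => s _.
by rewrite codiffK mul0rz.
Qed.

Definition supp_in (B : {set T} -> Prop) (u : A) := forall s, u s != 0 -> B s.

Lemma supp_in0 B : supp_in B 0.
Proof. by move=> s; rewrite ffunE eqxx. Qed.

Lemma supp_inB B u v : supp_in B u -> supp_in B v -> supp_in B (u - v).
Proof.
move=> uB vB s; rewrite !ffunE; have [->|/uB//] := eqVneq (u s) 0.
by rewrite sub0r oppr_eq0 => /vB.
Qed.

Lemma supp_in_lin B c u : (forall s, u s != 0 -> supp_in B (c (srt s))) ->
  supp_in B (lin c u).
Proof.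
move=> cB s; rewrite sum_ffunE => h.
have [t tn] : exists t, (c (srt t) *~ u t) s != 0.
  apply/existsP; apply: contraNT h; rewrite negb_exists => /forallP h.
  by rewrite big1 // => t _; apply/eqP; have := h t; rewrite negbK.
apply: (cB t); first by apply: contraNneq tn => ->; rewrite mulr0z ffunE.
by apply: contraNneq tn => e; rewrite ffunMzE e mul0rz.
Qed.

End Chains.

(** * Discrete homotopies *)

(** A point of the prism is a function on [option T]: the coordinate [None] is
    the time and the coordinates [Some x] are barycentric.  In this way one
    notion of mesh controls time and space together. *)
Section Homotopy.
Context {R : realFieldType} {T : finType} (rk : T -> nat).
Hypothesis rk_inj : injective rk.
Notation A := {ffun {set T} -> int}.
Notation Pt := (option T -> R).
Implicit Types (s t : {set T}) (x : T) (l r : seq Pt) (e : R).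

Definition in_prism (s : {set T}) (y : Pt) :=
  [/\ forall o, 0 <= y o <= 1, \sum_x y (Some x) = 1 &
      forall x, x \notin s -> y (Some x) = 0].

Lemma in_prism_bary s : bary_closed (in_prism s).
Proof.
move=> l l0 ls; split.
- move=> o; apply/andP; split.
    by apply: bary_ge => // y /ls[/(_ o)/andP[]].
  by apply: bary_le => // y /ls[/(_ o)/andP[]].
- rewrite -mulr_suml exchange_big /= big_seq (eq_bigr (fun=> 1)) => [|y /ls[]//].
  rewrite -big_seq big_const_seq count_predT iter_addr_0 divff //.
  by rewrite pnatr_eq0 -lt0n.
- by move=> x xs; apply: bary_eq => // y /ls[_ _]; apply.
Qed.

Lemma in_prism_time_bary s e : bary_closed (fun y => in_prism s y /\ y None = e).
Proof.
move=> l l0 ls; split; first by apply: in_prism_bary => // y /ls[].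
by apply: bary_eq => // y /ls[].
Qed.

Lemma in_prism_mesh s (l : seq Pt) : {in l, forall y, in_prism s y} -> mesh_le 1 l.
Proof.
move=> ls y z /ls[+ _ _] /ls[+ _ _] o => /(_ o)/andP[y0 y1] /(_ o)/andP[z0 z1].
rewrite ler_norml lerBrDr lerBlDl [-1 + _]addrC (le_trans _ y0) ?subr_le0 //=.
by rewrite (le_trans y1) ?lerDr.
Qed.

Definition vertex (e : R) (x : T) : Pt := fun o => if o is Some y then (x == y)%:R else e.

Lemma in_prism_vertex s x e : 0 <= e <= 1 -> x \in s -> in_prism s (vertex e x).
Proof.
move=> e01 xs; split.
- by case=> [y|] //=; case: eqP; rewrite ?lexx ?ler01.
- rewrite (bigD1 x) //= eqxx big1 ?addr0 // => y.
  by rewrite eq_sym => /negbTE->.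
- by move=> y ys /=; case: eqP => // xy; rewrite -xy xs in ys.
Qed.

(** [f] is a discretized homotopy: it labels the points of the prism by
    vertices, starts as a simplicial approximation of the identity, ends
    constant, and is simplicial on tuples as small as those of the
    [m]-th subdivision. *)
Variables (K : {set {set T}}) (w : T) (f : Pt -> T) (m : nat).
Hypothesis K_sub : forall s t, s \in K -> t \subset s -> t \in K.
Hypothesis Kw : [set w] \in K.
Hypothesis f_start : forall s y, s \in K -> in_prism s y -> y None = 0 -> f y \in s.
Hypothesis f_end : forall s y, s \in K -> in_prism s y -> y None = 1 -> f y = w.
Hypothesis f_small : forall s (l : seq Pt), s \in K -> {in l, forall y, in_prism s y} ->
  mesh_le ((1 - #|T|.+1%:R^-1) ^+ m) l -> [set x in map f l] \in K.

Let Theta (l : seq Pt) : A := simplex rk (map f l).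
Let Psi := iter m (@subdiv _ bary A) Theta.

Let bd_Psi l : bd rk (Psi l) = codiff Psi l.
Proof.
rewrite /Psi raddf_iter_subdiv -iter_subdiv_codiff; apply: eq_iter_subdiv => {}l.
by rewrite /= /Theta bd_simplex // codiff_map.
Qed.

(** [Psi] lives on the simplices that [f] spans on small tuples in the prism.
    The bound [#|T|.+1] on the size allows for the extra vertex of a prism. *)
Let supp_Psi (D : Pt -> Prop) (B : {set T} -> Prop) s (l : seq Pt) :
  bary_closed D -> (forall y, D y -> in_prism s y) -> {in l, forall y, D y} ->
  (size l <= #|T|.+1)%N ->
  (forall r, size r = size l -> {in r, forall y, D y} ->
     mesh_le ((1 - #|T|.+1%:R^-1) ^+ m) r -> #|[set x in map f r]| = size l ->
     B [set x in map f r]) ->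
  supp_in B (Psi l).
Proof.
move=> bD Ds lD lT h.
apply: (iter_subdiv_ind (@supp_in0 _ B) (@supp_inB _ B) (D := D) (d := 1) bD lT) => //.
  by apply: (in_prism_mesh (s := s)) => y /lD/Ds.
move=> r rl rD rm t /(simplex_supp)[-> ct]; apply: h => //.
  by rewrite mulr1 in rm.
by rewrite ct size_map.
Qed.

Let Phi e (l : seq T) := Psi (map (vertex e) l).

Let bd_Phi e (l : seq T) : bd rk (Phi e l) = codiff (Phi e) l.
Proof. by rewrite bd_Psi codiff_map. Qed.

Let srt_prism s e : 0 <= e <= 1 ->
  {in map (vertex e) (srt rk s), forall y, in_prism s y /\ y None = e}.
Proof.
move=> e01 y /mapP[x]; rewrite mem_srt => xs ->.
by split => //; apply: in_prism_vertex.
Qed.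

Let size_srt_le e s : (size (map (vertex e) (srt rk s)) <= #|T|.+1)%N.
Proof. by rewrite size_map size_srt ltnW // ltnS max_card. Qed.

Let Phi0 s : s \in K -> Phi 0 (srt rk s) = delta s.
Proof.
move=> sK; apply: (carried_chain_map_id rk_inj (c := Phi 0) (K := K)) => //.
- by move=> s1 x sK1; apply: (K_sub sK1); apply: finset.subD1set.
- by rewrite /Phi /Psi /=; elim: (m) => //= k IH; rewrite subdiv_nil.
- move=> {}s {}sK.
  suff: supp_in (fun t => t \subset s /\ #|t| = #|s|) (Phi 0 (srt rk s)) by [].
  apply: (supp_Psi (s := s) (@in_prism_time_bary s 0) _ (srt_prism _) (size_srt_le _ _)).
  - by move=> y [].
  - by rewrite lexx ler01.
  move=> r rs rD _ c; rewrite c size_map size_srt; split => //.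
  apply/fintype.subsetP => x; rewrite inE => /mapP[y yr ->].
  by have [] := rD _ yr; apply: f_start.
Qed.

(** A cycle [u] is homologous to [z], its image at time 1, through the prism;
    [z] is a cycle on the single vertex [w], hence the boundary of its own
    cone from [w]. *)
Lemma discrete_homotopy n (u : A) :
  supp_in (fun s => s \in K /\ #|s| = n) u -> bd rk u = 0 ->
  exists2 v : A, supp_in (fun s => s \in K /\ #|s| = n.+1) v & bd rk v = u.
Proof.
move=> uK u0.
pose H := prism (vertex 0) (vertex 1) Psi.
pose z := lin rk (Phi 1) u.
have lin0 c : lin rk c (bd rk u) = 0 :> A.
  by rewrite u0; apply: big1 => s _; rewrite ffunE mulr0z.
have bdz : bd rk z = 0.
  rewrite lin_raddf -(lin0 (Phi 1)) lin_bd //; apply: eq_lin => s _; exact: bd_Phi.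
(* The prism identity; the term with the coboundary of [H] vanishes on the
   cycle [u]. *)
have zu : bd rk (lin rk H u) = z - u.
  have bdH (l : seq T) : bd rk (H l) = (Phi 1 l - Phi 0 l) - codiff H l.
    rewrite -codiff_prism [RHS]addrAC subrr add0r raddf_prism.
    by apply: eq_prism => t; exact: bd_Psi.
  rewrite lin_raddf.
  rewrite (eq_lin (d := fun l : seq T => (Phi 1 l - Phi 0 l) - codiff H l)); last first.
    by move=> s _; exact: bdH.
  rewrite !linB -(lin_bd _ H) // lin0 subr0; congr (_ - _).
  rewrite -[RHS](lin_delta rk).
  apply: eq_lin => s us; rewrite Phi0; last by have [] := uK _ us.
  by congr delta; apply/setP => x; rewrite inE mem_srt.
exists (wedge rk w z - lin rk H u); last first.
  by rewrite raddfB /= bd_wedge // bdz raddf0 zu subr0 opprB addrC subrK.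
apply: supp_inB.
  have zw : supp_in (fun s => s \subset [set w] /\ #|s| = n) z.
    apply: supp_in_lin => s us; have [sK sn] := uK _ us.
    apply: (supp_Psi (s := s) (@in_prism_time_bary s 1) _ (srt_prism _) (size_srt_le _ _)).
    - by move=> y [].
    - by rewrite lexx ler01.
    move=> r rs rD _ ->; rewrite size_map size_srt; split => //.
    apply/fintype.subsetP => x; rewrite !inE => /mapP[y yr ->].
    by have [ys y1] := rD _ yr; rewrite (f_end sK ys y1).
  move=> s; rewrite ffunE; case: ifP => [ws|]; last by rewrite eqxx.
  rewrite mulf_eq0 negb_or => /andP[_ /zw[sw sn]].
  split; last by rewrite (cardsD1 w) ws sn.
  by move: sw; rewrite finset.subDset finset.setUid; apply: (K_sub Kw).
apply: supp_in_lin => s us; have [sK sn] := uK _ us.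
apply: (prism_ind (@supp_in0 _ _) (@supp_inB _ _)) => l ls lsub.
apply: (supp_Psi (s := s) (@in_prism_bary s)) => //.
- move=> y /lsub; rewrite mem_cat => /orP[] /srt_prism[] //.
    by rewrite lexx ler01.
  by rewrite lexx ler01.
- by rewrite ls size_srt ltnS max_card.
move=> r rl rD rm ->; split; last by rewrite ls size_srt sn.
exact: (f_small sK rD rm).
Qed.

End Homotopy.

(** * Uniform continuity of homotopies *)

Section Topology.
Local Open Scope classical_set_scope.

(** The index set is a vertex set, which carries no topology. *)
Lemma ptws_cvg (U : eqType) (V : topologicalType) (F : set_system {ptws U -> V})
    (f : {ptws U -> V}) : Filter F ->
  (forall x, (fun g : {ptws U -> V} => g x) @ F --> f x) -> F --> f.
Proof.
move=> FF Fx; apply/cvg_sup => i; rewrite cvg_image; last first.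
  by rewrite eqEsubset; split=> v // _; exists (cst v).
move=> W /Fx FW; exists (@^~ i @^-1` W) => //.
by rewrite eqEsubset; split => [j [? + <-//]|j Wj]; exists (fun _ => j).
Qed.

Lemma ptws_continuous (S : topologicalType) (U : eqType) (V : topologicalType)
    (f : S -> {ptws U -> V}) :
  (forall x, continuous (fun a => f a x)) -> continuous f.
Proof. by move=> fc a; apply: ptws_cvg => x; exact: fc. Qed.

Lemma pair_continuous (S U V : topologicalType) (f : S -> U) (g : S -> V) :
  continuous f -> continuous g -> continuous (fun a => (f a, g a)).
Proof. by move=> fc gc a; apply: cvg_pair; [exact: fc|exact: gc]. Qed.

Lemma sum_continuous (S : topologicalType) (K : numFieldType) (J : Type) (r : seq J)
    (f : J -> S -> K) :
  (forall x, continuous (f x)) -> continuous (fun a => \sum_(x <- r) f x a).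
Proof.
move=> fc; elim: r => [|x r IH].
  by under eq_fun do rewrite big_nil; exact: cst_continuous.
under eq_fun do rewrite big_cons; move=> a.
by apply: cvgD; [exact: fc|exact: IH].
Qed.

Lemma ptws_coord_cvg (U : eqType) (V : topologicalType) (x : U) (f : {ptws U -> V}) :
  (fun g : {ptws U -> V} => g x) @ f --> f x.
Proof. exact: (@proj_continuous U (fun=> V) x). Qed.

Lemma ex_expn_le (R : realType) (k e : R) : 0 <= k < 1 -> 0 < e ->
  exists m, k ^+ m <= e.
Proof.
move=> /andP[k0 k1] e0.
have /cvgrPdist_le/(_ e e0)[m _ /(_ m (leqnn m))] : GRing.exp k @ \oo --> (0 : R).
  by apply: cvg_expr; rewrite ger0_norm.
by rewrite /= sub0r normrN ger0_norm ?exprn_ge0 //; exists m.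
Qed.

(** Compactness is transported to row vectors, whose balls are given by
    coordinatewise distance; [crd] reads a row as a function on [option T]. *)
Section UniformContinuity.
Context {R : realType} {T : finType}.
Variables (X : set {ptws T -> R}) (F : R * {ptws T -> R} -> {ptws T -> R}).
Hypothesis F_cont : {within `[0, 1] `*` X, continuous F}.
Variable s : {set T}.
Hypothesis sX : forall y : option T -> R, in_prism s y -> X (y \o Some).

Let at_pt (y : option T -> R) : {ptws T -> R} := F (y None, y \o Some).

Let crd (M : 'rV[R]_#|{: option T}|) : option T -> R := fun o => M ord0 (enum_rank o).

Let crdc o : continuous (crd ^~ o).
Proof. by move=> M; exact: coord_continuous. Qed.

Let prism_compact : compact [set M | in_prism s (crd M)].
Proof.
pose box : set 'rV[R]_#|{: option T}| := [set M | forall i, `[0, 1]%classic (M ord0 i)].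
have box_compact : compact box.
  by apply: (@rV_compact R _ (fun=> `[0, 1]%classic)) => i; exact: segment_compact.
apply: (subclosed_compact _ box_compact); last first.
  move=> M [M01 _ _] i /=; rewrite in_itv /=.
  by have := M01 (enum_val i); rewrite /crd enum_valK.
rewrite (_ : mkset _ =
  (\bigcap_o ((crd ^~ o) @^-1` `[0, 1]%classic)) `&`
  (((fun M => \sum_x crd M (Some x)) @^-1` [set 1]) `&`
   (\bigcap_(x in [set x | x \notin s]) ((crd ^~ (Some x)) @^-1` [set 0])))).
  apply: closedI.
    apply: closed_bigI => o _; apply: (continuous_closedP _).1; first exact: crdc.
    exact: interval_closed.
  apply: closedI.
    apply: (continuous_closedP _).1; last exact: closed_eq.
    by apply: sum_continuous => x; exact: crdc.
  apply: closed_bigI => x _; apply: (continuous_closedP _).1; first exact: crdc.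
  exact: closed_eq.
apply/seteqP; split => M /=.
  move=> [h1 h2 h3]; split; [|split] => //.
  by move=> o _; rewrite /= in_itv; exact: h1.
move=> [h1 [h2 h3]]; split => //.
by move=> o; have := h1 o I; rewrite /= in_itv.
Qed.

(** Heine-Cantor for a map that is continuous only within the prism.  The
    compact set is covered by balls of radius [r / 2] around points [M] where
    the variation on the ball of radius [r] is below [e / 2]; two points that
    are [r / 2]-close to each other, one of them in the smaller ball, both
    lie in the larger one. *)
Lemma unif_cont_prism (e : R) : 0 < e -> exists2 d, 0 < d &
  forall y z, in_prism s y -> in_prism s z -> (forall o, `|y o - z o| <= d) ->
  forall x, `|at_pt y x - at_pt z x| < e.
Proof.
move=> e0.
pose P (d : R) (M : 'rV[R]_#|{: option T}|) := in_prism s (crd M) ->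
  forall N, in_prism s (crd N) -> (forall o, `|crd M o - crd N o| <= d) ->
  forall x, `|at_pt (crd M) x - at_pt (crd N) x| < e.
pose E (M : 'rV[R]_#|{: option T}|) : R * {ptws T -> R} := (crd M None, crd M \o Some).
have Ec : continuous E.
  apply: pair_continuous; first exact: crdc.
  by apply: ptws_continuous => x; exact: crdc.
have EA M : in_prism s (crd M) -> (`[0, 1] `*` X) (E M).
  move=> sM; split; last exact: sX.
  by have [/(_ None)] := sM; rewrite /= in_itv.
suff : \forall d \near (0 : R)^'+, [set M | in_prism s (crd M)] `<=` P d.
  move=> H; near (0 : R)^'+ => d.
  have Hd : [set M | in_prism s (crd M)] `<=` P d by near: d; exact: H.
  exists d => // y z sy sz yz.
  have rowK (y' : option T -> R) : crd (\row_i y' (enum_val i)) = y'.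
    by apply/funext => o; rewrite /crd mxE enum_rankK.
  have := Hd (\row_i y (enum_val i)).
  rewrite /P /= rowK => /(_ sy sy (\row_i z (enum_val i))).
  by rewrite rowK => /(_ sz yz).
apply: (compact_near_coveringP _).1 prism_compact _ _ _ _ _ => M sM.
have Fc := (subspace_continuousP _ _).1 F_cont (E M) (EA M sM).
have near1 x : \forall N \near M, in_prism s (crd N) ->
    `|at_pt (crd M) x - at_pt (crd N) x| < e / 2.
  have e20 : 0 < e / 2 by rewrite divr_gt0.
  have /cvgrPdist_lt/(_ _ e20) :
      (fun a => F a x) @ within (`[0, 1] `*` X) (nbhs (E M)) --> F (E M) x.
    apply: (@cvg_comp _ _ _ F (fun g : {ptws T -> R} => g x) _ _ _ Fc).
    exact: ptws_coord_cvg.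
  move=> /(Ec M) H; near=> N => sN.
  suff : (`[0, 1] `*` X) (E N) -> `|at_pt (crd M) x - at_pt (crd N) x| < e / 2.
    by apply; exact: EA.
  by near: N; exact: H.
have /nbhs_ballP[r r0 Hr] : \forall N \near M, in_prism s (crd N) ->
    forall x, `|at_pt (crd M) x - at_pt (crd N) x| < e / 2.
  near=> N => sN x; move: x sN; near: N.
  exact: (@filter_forall _ _ _ _ (nbhs_filter M) near1).
exists (ball M (r / 2), [set d | 0 < d < r / 2]).
  split; first by apply: nbhsx_ballx; rewrite divr_gt0.
  near=> d; apply/andP; split => //; near: d.
  by apply: nbhs_right_lt; rewrite divr_gt0.
move=> [N d] [/= MN /andP[d0 dr]] sN L sL NL x.
have bN : ball M r N.
  by apply: le_ball MN; rewrite ler_pdivrMr // mulr_natr mulr2n lerDl ltW.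
have bL : ball M r L.
  rewrite (splitr r); apply: (ball_triangle MN).
  split; first by rewrite divr_gt0.
  move=> i j; rewrite /ball /= !ord1.
  have := NL (enum_val j); rewrite /crd enum_valK => h.
  exact: le_lt_trans h dr.
rewrite (splitr e); apply: le_lt_trans (ler_distD (at_pt (crd M) x) _ _) _.
by apply: ltrD; [rewrite distrC|]; apply: Hr.
Unshelve. all: end_near. Qed.

End UniformContinuity.

End Topology.

(** * Order complexes *)

Section OrderComplex.
Context {disp : Order.disp_t} {T : finPOrderType disp}.
Implicit Types (P s t : {set T}) (x y z : T).

Lemma order_complexP P s : reflect
  (s \subset P /\ {in s &, forall x y, (x >=< y)%O}) (s \in order_complex P).
Proof.
rewrite inE; apply: (iffP andP) => -[sP].
  by move=> /forall_inP h; split => // x y /h/forall_inP; apply.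
by move=> h; split => //; apply/forall_inP => x xs; apply/forall_inP => y; apply: h.
Qed.

Lemma order_complex_sub P s t : s \in order_complex P -> t \subset s ->
  t \in order_complex P.
Proof.
move=> /order_complexP[sP sc] ts; apply/order_complexP; split.
  exact: fintype.subset_trans sP.
by move=> x y /(fintype.subsetP ts) xs /(fintype.subsetP ts); apply: sc.
Qed.

Lemma order_complex0 P : finset.set0 \in order_complex P.
Proof.
by apply/order_complexP; split; [exact: finset.sub0set|move=> x y; rewrite inE].
Qed.

(** A linear extension of the order: elements with fewer predecessors come
    first, and the enumeration of [T] breaks ties. *)
Definition lin_rank x : nat :=
  (#|[set y | (y < x)%O]%SET| * #|T| + enum_rank x)%N.

Lemma lin_rank_lt x y : (x < y)%O -> (lin_rank x < lin_rank y)%N.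
Proof.
move=> xy; rewrite /lin_rank.
have lt : (#|[set z | (z < x)%O]%SET| < #|[set z | (z < y)%O]%SET|)%N.
  apply: proper_card; apply/properP; split.
    by apply/fintype.subsetP => z; rewrite !inE => zx; apply: lt_trans xy.
  by exists x; rewrite !inE ?ltxx.
apply: (@leq_trans (#|[set z | (z < x)%O]%SET|.+1 * #|T|)).
  by rewrite mulSn addnC ltn_add2r.
by apply: leq_trans (leq_addr _ _); rewrite leq_mul2r lt orbT.
Qed.

Lemma lin_rank_inj : injective lin_rank.
Proof.
move=> x y /(congr1 (modn ^~ #|T|)).
by rewrite !modnMDl !modn_small // => /ord_inj/enum_rank_inj.
Qed.

Lemma lin_rank_ltE P s : s \in order_complex P ->
  {in s &, forall x y, (lin_rank x < lin_rank y)%N = (x < y)%O}.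
Proof.
move=> /order_complexP[_ sc] x y xs ys; apply/idP/idP; last exact: lin_rank_lt.
case: (comparable_ltgtP (sc _ _ xs ys)) => // [/lin_rank_lt yx|->].
  by rewrite ltnNge ltnW.
by rewrite ltnn.
Qed.

(** On a chain of the poset, the order of [T] and its linear extension give the
    same positions, hence the same signs. *)
Lemma boundary_bd P n (u : {ffun {set T} -> int}) : simplicial_chain P n u ->
  boundary u = bd lin_rank u.
Proof.
move=> uP; apply/ffunP => s; rewrite !ffunE.
rewrite (exchange_big_dep xpredT) //= [RHS]big_mkcond; apply: eq_bigr => x _.
case: ifP => xs; last first.
  rewrite big1 // => t /andP[xt /eqP ts].
  by move: xs; rewrite -ts finset.setD11.
rewrite (big_pred1 (x |: s)%SET) => [|t /=]; last first.
  apply/andP/eqP => [[xt /eqP<-]|->]; first by rewrite finset.setD1K.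
  by rewrite finset.setU11 finset.setU1K.
have [->|/uP/andP[sK _]] := eqVneq (u (x |: s)%SET) 0; first by rewrite !mulr0.
congr (_ ^+ _ * _); apply: eq_card => y; rewrite !inE.
have [->|yx] := eqVneq y x; first by rewrite ltxx ltnn !andbF.
rewrite /=; case ys: (y \in s) => //=.
by rewrite (lin_rank_ltE sK) // !inE ?eqxx ?ys ?orbT.
Qed.

End OrderComplex.

(** * Contractible order complexes are acyclic *)

Section ContractibleAcyclic.
Context {disp : Order.disp_t} {T : finPOrderType disp}.
Variable (R : realType).
Implicit Types (P s t : {set T}).

(** The homotopy is discretized by choosing at each point a vertex [pk] whose
    coordinate is at least [c = 1 / #|T|].  Where the homotopy varies by less
    than [c] on a tuple, the chosen vertices all have positive coordinates at
    one point of the tuple, so they lie in the simplex that supports it. *)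
Lemma contractible_acyclic P : contractible R (realization R P) -> Z_acyclic P.
Proof.
move=> [x0 [F [X0 F_cont F_stab F0 F1]]] n u uP u0.
set X := realization R P in X0 F_cont F_stab F0 F1.
pose K := order_complex P.
pose c : R := #|T|%:R^-1.
(* The coordinates add up to 1, so they are not all smaller than [c]. *)
have big_coord z : X z -> exists v, c <= z v.
  move=> [z0 z1 _]; apply/existsP; apply: contraT; rewrite negb_exists => /forallP h.
  have T0 : (0 < #|T|)%N.
    rewrite lt0n; apply: contra_eqN z1 => /eqP/card0_eq T0.
    by rewrite big1 ?(eq_sym 0) ?oner_eq0 // => v; have := T0 v; rewrite inE.
  have : \sum_x z x < \sum_(x : T) c.
    have [v0 _] : exists v, v \in T by apply/card_gt0P.
    by apply: ltr_sum => [|v _]; [apply/hasP; exists v0; rewrite ?mem_index_enum|rewrite ltNge].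
  by rewrite z1 sumr_const -mulr_natl divff ?ltxx // pnatr_eq0 -lt0n.
have [v0 _] := big_coord _ X0.
have c0 : 0 < c by rewrite invr_gt0 ltr0n; apply/card_gt0P; exists v0.
pose pk (z : T -> R) := odflt v0 [pick v | c <= z v].
have pkP z : X z -> c <= z (pk z).
  move=> /big_coord[v vz]; rewrite /pk; case: pickP => //= h.
  by rewrite h in vz.
pose at_pt (y : option T -> R) : {ptws T -> R} := F (y None, y \o Some).
have prismX s y : s \in K -> in_prism s y -> X (y \o Some).
  move=> sK [y01 ysum ys]; split => //.
    by move=> x; have /andP[] := y01 (Some x).
  apply: (order_complex_sub sK); apply/fintype.subsetP => x; rewrite inE.
  by apply: contraNT => /ys/= ->.
have atX s y : s \in K -> in_prism s y -> X (at_pt y).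
  move=> sK sy; apply: F_stab; first by have [] := sy.
  exact: prismX sy.
have supp_pk z : X z -> [set x | z x != 0]%SET \in K by case.
have [d d0 dP] : exists2 d : R, 0 < d & forall s, s \in K -> forall y z,
    in_prism s y -> in_prism s z -> (forall o, `|y o - z o| <= d) ->
    forall x, `|at_pt y x - at_pt z x| < c.
  have h s : exists d : R, 0 < d /\ (s \in K -> forall y z,
      in_prism s y -> in_prism s z -> (forall o, `|y o - z o| <= d) ->
      forall x, `|at_pt y x - at_pt z x| < c).
    have [sK|] := boolP (s \in K); last by exists 1.
    have [d d0 dP] := unif_cont_prism F_cont (fun y => prismX s y sK) c0.
    by exists d; split.
  have [d_ dP] := fin_all_exists h.
  (* A single mesh bound for all the finitely many simplices. *)
  exists (\big[Num.min/1]_s d_ s).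
    by elim/big_ind: _ => [|a b a0 b0|s _]; rewrite ?lt_min ?a0 ?b0 //; have [] := dP s.
  move=> s sK y z sy sz yz x; have [_ h'] := dP s; apply: h' => // o.
  by apply: le_trans (yz o) _; apply: bigmin_le_cond.
have [m mP] : exists m, (1 - #|T|.+1%:R^-1 : R) ^+ m <= d.
  apply: ex_expn_le => //; rewrite subr_ge0 invf_le1 ?ltr0n // ler1n /=.
  by rewrite ltrBlDr ltrDl invr_gt0 ltr0n.
have Kw : [set pk x0]%SET \in K.
  apply: (order_complex_sub (supp_pk _ X0)).
  by rewrite finset.sub1set inE gt_eqF // (lt_le_trans c0) ?pkP.
have [|||||v vK vu] := @discrete_homotopy R T lin_rank lin_rank_inj K (pk x0)
  (pk \o at_pt) m (@order_complex_sub _ _ P) Kw _ _ _ n u.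
- move=> s y sK sy y0 /=; have [_ _ ys] := sy; apply: contraTT isT => ns.
  have : c <= (y \o Some) (pk (at_pt y)).
    rewrite -[X in c <= X (pk _)]F0; last exact: prismX sy.
    have := pkP _ (atX _ _ sK sy); rewrite /at_pt y0 //.
  by rewrite /= ys // leNgt c0.
- move=> s y sK sy y1 /=; rewrite /at_pt y1 F1 //; exact: prismX sy.
- move=> s [|y l] sK sl lm.
    by rewrite (_ : [set _ in _]%SET = finset.set0) ?order_complex0.
  have sy : in_prism s y by apply: sl; rewrite inE eqxx.
  apply: (order_complex_sub (supp_pk _ (atX _ _ sK sy))).
  apply/fintype.subsetP => x; rewrite inE => /mapP[z zl ->].
  have sz := sl _ zl.
  have := dP s sK z y sz sy _ (pk (at_pt z)).
  rewrite inE /=; have pz := pkP _ (atX _ _ sK sz).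
  move=> h; apply: contraTneq pz => e; rewrite -ltNge.
  apply: le_lt_trans (ler_norm _) _.
  move: h; rewrite e subr0; apply => o.
  by apply: le_trans mP; apply: lm => //; rewrite inE eqxx.
- by move=> s /uP/andP[sK /eqP].
- by rewrite -(boundary_bd uP).
have vP : simplicial_chain P n.+1 v by move=> s /vK[-> ->]; rewrite eqxx.
by exists v => //; rewrite (boundary_bd vP).
Qed.

End ContractibleAcyclic.

(** * Euler characteristic and smallest elements of chains *)

Section Euler.
Context {disp : Order.disp_t} {T : finPOrderType disp}.
Implicit Types (P Q c s t : {set T}) (x y z : T).

Definition chains P k : {set {set T}} := [set c in order_complex P | #|c| == k]%SET.

(** Minus the reduced Euler characteristic; the empty chain is counted. *)
Definition altsum P : int := \sum_(c in order_complex P) (-1) ^+ #|c|.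

Lemma altsumE P : altsum P = \sum_(k < #|P|.+1) (-1) ^+ k *+ #|chains P k|.
Proof.
rewrite /altsum (partition_big (fun c => inord #|c| : 'I_#|P|.+1) xpredT) //=.
apply: eq_bigr => k _; rewrite -sumr_const; apply: congr_big => // [c|c].
  rewrite [RHS]inE; case cP: (c \in _) => //=.
  have [/subset_leq_card cP' _] := order_complexP _ _ cP.
  by rewrite -val_eqE /= inordK.
move=> /andP[cP]; have [/subset_leq_card cP' _] := order_complexP _ _ cP.
by rewrite -val_eqE /= inordK // => /eqP->.
Qed.

Lemma chains0 P : chains P 0 = [set finset.set0]%SET.
Proof.
apply/setP => c; rewrite !inE cards_eq0; case: eqP => [->|]; last by rewrite andbF.
by have := order_complex0 P; rewrite inE => ->.
Qed.

Lemma euler_charE P : euler_char P = 1 - altsum P.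
Proof.
rewrite altsumE big_ord_recl /= chains0 cards1 expr0 mulr1n opprD addrA subrr add0r.
by rewrite -sumrN; apply: eq_bigr => i _; rewrite /bump /= add1n exprS mulN1r mulNrn opprK.
Qed.

Definition above Q x := [set y in Q | (x < y)%O]%SET.

Lemma chain_min P c : c \in order_complex P -> c != finset.set0 ->
  exists2 x, x \in c & {in c, forall y, (x <= y)%O}.
Proof.
move=> cP /set0Pn[x0 x0c]; case: (arg_minnP (@lin_rank _ T) x0c) => x xc xm.
exists x => // y yc; have [_ /(_ x y xc yc)] := order_complexP _ _ cP.
case/comparable_leP => // yx; have := xm y yc.
by rewrite leqNgt lin_rank_lt.
Qed.

(** A nonempty chain is its smallest element [x] together with a chain strictly
    above [x]; removing [x] changes the sign. *)
Lemma altsum_above Q : altsum Q = 1 - \sum_(x in Q) altsum (above Q x).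
Proof.
rewrite /altsum (bigD1 finset.set0) ?order_complex0 //= cards0 expr0; congr (_ + _).
pose is_min x c := (x \in c) && [forall y in c, (x <= y)%O].
transitivity (\sum_(c | (c \in order_complex Q) && (c != finset.set0))
    \sum_(x | is_min x c) (-1) ^+ #|c| : int).
  apply: eq_bigr => c /andP[cQ c0].
  have [x xc xm] := chain_min cQ c0.
  rewrite (big_pred1 x) // => y; apply/andP/eqP => [[yc /forall_inP ym]|->].
    by apply/le_anti; rewrite ym //= xm.
  by split => //; apply/forall_inP.
rewrite (exchange_big_dep (mem Q)) /=; last first.
  move=> c x /andP[/order_complexP[cQ _] _] /andP[xc _].
  exact: (fintype.subsetP cQ).
rewrite -sumrN; apply: eq_bigr => x xQ; rewrite -sumrN.
(* Chains with smallest element [x] are the sets [x |: c] for a chain [c] of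
   [above Q x]. *)
rewrite (reindex_onto (fun c => x |: c)%SET (fun c => c :\ x)%SET) /=; last first.
  by move=> c /andP[_ /andP[xc _]]; rewrite finset.setD1K.
symmetry; apply: congr_big => // [c|c].
  symmetry; apply/idP/idP => [/andP[/andP[/andP[cQ _] /andP[_ /forall_inP xm]] /eqP cx]|].
    have xc : x \notin c by rewrite -cx finset.setD11.
    have [cQ' cc] := order_complexP _ _ cQ.
    apply/order_complexP; split.
      apply/fintype.subsetP => y yc; rewrite inE (fintype.subsetP cQ') ?inE ?yc ?orbT //=.
      rewrite lt_neqAle xm ?inE ?yc ?orbT // andbT.
      by apply: contraNneq xc => ->.
    by move=> y z yc zc; apply: cc; rewrite inE ?yc ?zc orbT.
  move=> /order_complexP[/fintype.subsetP ca cc].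
  have xc : x \notin c by apply/negP => /ca; rewrite inE ltxx andbF.
  rewrite finset.setU1K // eqxx andbT; apply/andP; split; [apply/andP; split|].
  - apply/order_complexP; split.
      rewrite finset.subUset finset.sub1set xQ; apply/fintype.subsetP => y /ca.
      by rewrite inE => /andP[].
    have lx y : y \in c -> (x < y)%O by move=> /ca; rewrite inE => /andP[].
    move=> y z; rewrite !inE => /predU1P[->|yc] /predU1P[->|zc]; rewrite ?comparablexx //.
    + by rewrite /Order.comparable ltW ?lx.
    + by rewrite /Order.comparable (ltW (lx y yc)) orbT.
    + exact: cc.
  - by apply/set0Pn; exists x; rewrite finset.setU11.
  rewrite /is_min finset.setU11; apply/forall_inP => y; rewrite !inE.
  by move=> /predU1P[->//|/ca]; rewrite inE => /andP[_ /ltW].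
move=> /order_complexP[/fintype.subsetP ca cc].
have xc : x \notin c by apply/negP => /ca; rewrite inE ltxx andbF.
by rewrite cardsU1 xc add1n exprS mulN1r.
Qed.

Lemma above_above Q x y : (x < y)%O -> above (above Q x) y = above Q y.
Proof.
move=> xy; apply/setP => z; rewrite !inE; case: (z \in Q) => //=.
by apply/andP/idP => [[]//|yz]; rewrite (lt_trans xy yz).
Qed.

Lemma altsum_above_rec Q x :
  altsum (above Q x) = 1 - \sum_(y in Q | (x < y)%O) altsum (above Q y).
Proof.
rewrite altsum_above; congr (1 - _); apply: congr_big => // [y|y].
  by rewrite inE.
by rewrite inE => /andP[_ xy]; rewrite above_above.
Qed.

Lemma euler_char_above Q : euler_char Q = \sum_(x in Q) altsum (above Q x).
Proof. by rewrite euler_charE altsum_above subKr. Qed.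

End Euler.

(** * Acyclic posets have Euler characteristic 1 *)

Section EulerPoincare.
Context {disp : Order.disp_t} {T : finPOrderType disp}.
Implicit Types (P s t : {set T}).
Notation V := {ffun {set T} -> rat^o}.

Definition boundaryQ (u : V) : V :=
  [ffun s : {set T} => \sum_(t : {set T}) \sum_(x in t | (t :\ x)%SET == s)
     (-1) ^+ #|[set y in t | (y < x)%O]%SET| * u t].

Lemma boundaryQ_is_linear : linear boundaryQ.
Proof.
move=> a u v; apply/ffunP => s; rewrite !ffunE scaler_sumr -big_split /=.
apply: eq_bigr => t _; rewrite scaler_sumr -big_split /=; apply: eq_bigr => x _.
by rewrite !ffunE mulrDr; congr (_ + _); rewrite /GRing.scale /= mulrCA.
Qed.
HB.instance Definition _ := GRing.isLinear.Build rat V V _ boundaryQ boundaryQ_is_linear.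

Let d := linfun boundaryQ.

Let dE u : d u = boundaryQ u. Proof. by rewrite lfunE. Qed.

Definition toQ (u : {ffun {set T} -> int}) : V := [ffun s => (u s)%:~R].

Lemma boundaryQ_toQ u : boundaryQ (toQ u) = toQ (boundary u).
Proof.
apply/ffunP => s; rewrite !ffunE rmorph_sum; apply: eq_bigr => t _.
rewrite rmorph_sum; apply: eq_bigr => x _.
by rewrite ffunE rmorphM rmorphXn rmorphN1.
Qed.

Lemma toQ_inj : injective toQ.
Proof.
by move=> u v /ffunP e; apply/ffunP => s; have := e s; rewrite !ffunE => /intr_inj.
Qed.

(** Clearing denominators: exactness over the integers gives exactness over the
    rationals, where dimensions can be counted. *)
Lemma toQ_denom (u : V) : exists2 D : rat, D != 0 & exists u', D *: u = toQ u'.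
Proof.
exists (\prod_s (denq (u s))%:~R).
  by apply/prodf_neq0 => s _; rewrite intr_eq0 denq_neq0.
exists [ffun s => numq (u s) * \prod_(t | t != s) denq (u t)].
apply/ffunP => s; rewrite !ffunE (bigD1 s) //= /GRing.scale /= mulrAC.
rewrite rmorphM rmorph_prod /=; congr (_ * _).
by rewrite numqE mulrC.
Qed.

Lemma simplicial_chain_boundary P n (u : {ffun {set T} -> int}) :
  simplicial_chain P n.+1 u -> simplicial_chain P n (boundary u).
Proof.
move=> uP s; rewrite ffunE => h.
have [t [x [xt ts ut]]] : exists t x, [/\ x \in t, (t :\ x)%SET = s & u t != 0].
  apply: contrapT => no; move: h; rewrite big1 ?eqxx // => t _.
  rewrite big1 // => x /andP[xt /eqP ts].
  have [->|ut] := eqVneq (u t) 0; first by rewrite mulr0.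
  by case: no; exists t, x.
have /andP[tP /eqP ct] := uP _ ut.
rewrite -ts (order_complex_sub tP) ?finset.subD1set //=.
by have := cardsD1 x t; rewrite xt ct add1n => -[<-].
Qed.

Lemma boundaryK P n (u : {ffun {set T} -> int}) :
  simplicial_chain P n.+1 u -> boundary (boundary u) = 0.
Proof.
move=> uP; rewrite (boundary_bd (simplicial_chain_boundary uP)).
by rewrite (boundary_bd uP) bdK //; exact: lin_rank_inj.
Qed.

Definition deltaQ s : V := [ffun t => (t == s)%:R].

Lemma scale_ffunE (a : rat) (u : V) s : (a *: u) s = a * u s.
Proof. by rewrite ffunE. Qed.

Definition chain_space P k : {vspace V} := <<[seq deltaQ s | s <- enum (chains P k)]>>%VS.

Lemma chain_spaceP P k (u : V) :
  reflect (forall s, u s != 0 -> s \in chains P k) (u \in chain_space P k).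
Proof.
apply: (iffP idP) => [/coord_span e s|h].
  apply: contraNT => sK; rewrite e sum_ffunE big1 // => i _.
  rewrite ffunE (nth_map finset.set0) ?ffunE; last by rewrite -cardE.
  case: eqP => [es|]; last by rewrite scaler0.
  by move: sK; rewrite es -mem_enum mem_nth // -cardE.
have -> : u = \sum_(s in chains P k) u s *: deltaQ s.
  apply/ffunP => t; rewrite sum_ffunE.
  have [tK|tK] := boolP (t \in chains P k).
    rewrite (bigD1 t) //= big1 ?addr0 => [|s /andP[_ st]]; rewrite !ffunE.
      by rewrite eqxx /GRing.scale /= mulr1.
    by rewrite eq_sym (negbTE st) scaler0.
  rewrite big1; first by apply/eqP; apply: contraNT tK => /h.
  move=> s sK; rewrite !ffunE; case: eqP => [es|]; last by rewrite scaler0.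
  by rewrite es sK in tK.
by apply: memv_suml => s sK; apply: memvZ; apply: memv_span; apply: map_f; rewrite mem_enum.
Qed.

Lemma dim_chain_space P k : \dim (chain_space P k) = #|chains P k|.
Proof.
rewrite cardE -(size_map deltaQ); apply/eqP.
change (free [seq deltaQ s | s <- enum (chains P k)]).
apply/freeP => c c0 i.
have /ffunP/(_ (nth finset.set0 (enum (chains P k)) i)) := c0.
rewrite sum_ffunE (bigD1 i) //= big1 ?addr0 => [|j ji].
  rewrite scale_ffunE (nth_map finset.set0) -?cardE // !ffunE eqxx mulr1.
  by [].
rewrite scale_ffunE (nth_map finset.set0) -?cardE // !ffunE.
rewrite nth_uniq -?cardE ?enum_uniq //; case: eqP => [/ord_inj ij|]; last by rewrite mulr0.
by rewrite ij eqxx in ji.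
Qed.

Lemma acyclic_chain_exact P k : Z_acyclic P ->
  (chain_space P k :&: lker d)%VS = (d @: chain_space P k.+1)%VS.
Proof.
move=> acP; apply/vspaceP => u; apply/idP/idP.
  rewrite memv_cap memv_ker dE => /andP[/chain_spaceP uK /eqP du].
  have [D D0 [u' Du]] := toQ_denom u.
  have [||v vK bv] := acP k u'.
  - move=> s us; have : u s != 0.
      have /ffunP/(_ s) := Du; rewrite !ffunE => e.
      by apply: contraNneq us => us0; rewrite -(intr_eq0 rat) -e us0 scaler0.
    by move=> /uK; rewrite inE.
  - apply: toQ_inj; rewrite -boundaryQ_toQ -Du linearZ /= du scaler0.
    by apply/ffunP => s; rewrite !ffunE.
  have -> : u = d (D^-1 *: toQ v).
    by rewrite dE linearZ /= boundaryQ_toQ bv -Du scalerA mulVf // scale1r.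
  apply: memv_img; apply: memvZ; apply/chain_spaceP => s.
  by rewrite ffunE intr_eq0 => /vK sK; rewrite inE.
case/memv_imgP => v /chain_spaceP vK ->.
have [D D0 [v' Dv]] := toQ_denom v.
have v'K : simplicial_chain P k.+1 v'.
  move=> s vs; have : v s != 0.
    have /ffunP/(_ s) := Dv; rewrite !ffunE => e.
    by apply: contraNneq vs => vs0; rewrite -(intr_eq0 rat) -e vs0 scaler0.
  by move=> /vK; rewrite inE.
have -> : d v = D^-1 *: toQ (boundary v').
  by rewrite -boundaryQ_toQ -Dv linearZ /= scalerA mulVf // scale1r dE.
apply: memvZ; rewrite memv_cap memv_ker dE boundaryQ_toQ (boundaryK v'K).
apply/andP; split; last by apply/eqP/ffunP => s; rewrite !ffunE.
apply/chain_spaceP => s; rewrite ffunE intr_eq0.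
by move=> /(simplicial_chain_boundary v'K) sK; rewrite inE.
Qed.

(** By exactness, the number of simplices with [k] vertices is the sum of the
    ranks [r k] and [r k.+1] of two consecutive boundary maps, so the
    alternating sum telescopes to its two ends, which are zero. *)
Lemma acyclic_altsum P : Z_acyclic P -> altsum P = 0.
Proof.
move=> acP; pose r k := \dim (d @: chain_space P k).
have nr k : #|chains P k| = (r k.+1 + r k)%N.
  by rewrite -dim_chain_space -(limg_ker_dim d) acyclic_chain_exact.
have tele N : \sum_(k < N) (-1) ^+ k *+ #|chains P k| = (r 0%N)%:Z - (-1) ^+ N * (r N)%:Z.
  elim: N => [|N IH]; first by rewrite big_ord0 expr0 mul1r subrr.
  rewrite big_ord_recr /= IH nr -mulr_natr natrD exprS mulN1r mulNr opprK mulrDr !natz.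
  by rewrite -addrA; congr (_ + _); rewrite addrC addrK.
have r0 : r 0%N = 0%N.
  apply/eqP; rewrite dimv_eq0 -subv0; apply/subvP => _ /memv_imgP[u /chain_spaceP uK ->].
  rewrite memv0 dE; apply/eqP/ffunP => s; rewrite !ffunE big1 // => t _.
  rewrite big1 // => x /andP[xt _].
  have [->|/uK] := eqVneq (u t) 0; first by rewrite mulr0.
  by rewrite chains0 inE => /eqP t0; rewrite t0 inE in xt.
have rP : r #|P|.+1 = 0%N.
  have := nr #|P|.+1; rewrite (_ : chains P _ = finset.set0) ?cards0.
    by move/esym/eqP; rewrite addn_eq0 => /andP[_ /eqP].
  apply/setP => c; rewrite !inE; apply/negP => /andP[/andP[/subset_leq_card + _] /eqP e].
  by rewrite e ltnn.
by rewrite altsumE tele r0 rP mulr0 subrr.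
Qed.

Lemma acyclic_euler_char P : Z_acyclic P -> euler_char P = 1.
Proof. by move=> /acyclic_altsum a0; rewrite euler_charE a0 subr0. Qed.

End EulerPoincare.

(** * Posets with a largest element *)

Section Cone.
Local Open Scope classical_set_scope.
Context {disp : Order.disp_t} {T : finPOrderType disp}.
Variable (R : realType).

(** Adding [a] to a chain leaves a chain, so the straight segments towards the
    vertex [a] stay in the realization. *)
Lemma top_contractible (P : {set T}) (a : T) : a \in P ->
  (forall x, x \in P -> (x <= a)%O) -> contractible R (realization R P).
Proof.
move=> aP a_top.
pose vtx : {ptws T -> R} := fun x => (x == a)%:R.
pose F (q : R * {ptws T -> R}) : {ptws T -> R} :=
  fun x => (1 - q.1) * q.2 x + q.1 * vtx x.
have cone_simplex s : s \in order_complex P -> (a |: s)%SET \in order_complex P.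
  move=> /order_complexP[sP sc]; apply/order_complexP; split.
    by rewrite finset.subUset finset.sub1set aP.
  have ca x : x \in s -> (x <= a)%O by move=> /(fintype.subsetP sP)/a_top.
  move=> x y; rewrite !inE => /predU1P[->|xs] /predU1P[->|ys].
  - exact: comparablexx.
  - by rewrite /Order.comparable (ca y) ?orbT.
  - by rewrite /Order.comparable ca.
  - exact: sc.
have vtx_in : realization R P vtx.
  split.
  - by move=> x; apply: ler0n.
  - by rewrite (bigD1 a) //= /vtx eqxx big1 ?addr0 // => x /negbTE->.
  apply: (order_complex_sub (cone_simplex _ (order_complex0 P))).
  apply/fintype.subsetP => x; rewrite !inE /vtx pnatr_eq0.
  by case: (x == a).
exists vtx, F; split => //.
- apply: continuous_subspaceT; apply: ptws_continuous => x q.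
  have ct : (fun r : R * {ptws T -> R} => r.1) @ q --> q.1 by exact: cvg_fst.
  have cx : (fun r : R * {ptws T -> R} => r.2 x) @ q --> q.2 x.
    by apply: (cvg_comp snd (fun g : {ptws T -> R} => g x)); [exact: cvg_snd|exact: ptws_coord_cvg].
  have c1 : (fun r : R * {ptws T -> R} => 1 - r.1) @ q --> 1 - q.1.
    by apply: cvgB ct; exact: cvg_cst.
  have c2 : (fun r : R * {ptws T -> R} => r.1 * vtx x) @ q --> q.1 * vtx x.
    by apply: cvgM ct _; exact: cvg_cst.
  exact: (cvgD (cvgM c1 cx) c2).
- move=> t w /andP[t0 t1] [w0 w1 wP]; split.
  + move=> x; have := w0 x; have : 0 <= vtx x by exact: ler0n.
    by move=> v0 wx; rewrite addr_ge0 // mulr_ge0 //= subr_ge0.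
  + rewrite big_split /= -!mulr_sumr w1 mulr1.
    by have [_ -> _] := vtx_in; rewrite mulr1 subrK.
  apply: (order_complex_sub (cone_simplex _ wP)); apply/fintype.subsetP => x.
  rewrite !inE /F /vtx /=; have [//|xa] := boolP (x == a); rewrite mulr0 addr0 /=.
  by apply: contraNneq => ->; rewrite mulr0.
- by move=> w _; apply/funext => x; rewrite /F /= subr0 mul1r mul0r addr0.
- by move=> w _; apply/funext => x; rewrite /F /= subrr mul0r mul1r add0r.
Qed.

End Cone.

(** * The poset of cosets of p-subgroups *)

Section CosetPoset.
Context {gT : finGroupType} (G : {group gT}) (p : nat).
Implicit Types (H K : {group gT}) (D : {set gT}) (c : {set {set gT}}).

Let p_subgroups := (1%G |: nontrivial_p_subgroups p G)%SET.
Let C := coset_poset p G.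

Lemma p_subgroupsP H : (H \in p_subgroups) = (H \subset G) && (p.-group H)%g.
Proof.
rewrite !inE; have [->|H1] := eqVneq H 1%G; first by rewrite sub1G pgroup1.
by rewrite /= (_ : (H :!=: 1%g) = true) ?andbT //; apply: contraNneq H1 => /val_inj->.
Qed.

Lemma coset_posetP D : reflect
  (exists H x, [/\ H \in p_subgroups, x \in G & D = (H :* x)%g]) (D \in C).
Proof.
apply: (iffP imset2P) => [[H x HP xG ->]|[H [x [HP xG ->]]]]; first by exists H, x.
by exists H x.
Qed.

Lemma setle_subset (A B : {set gT}) : (A <= B)%O = (A \subset B).
Proof. by []. Qed.

Lemma setlt_proper (A B : {set gT}) : (A < B)%O = (A \proper B).
Proof. by rewrite lt_neqAle setle_subset finset.properEneq. Qed.

(** A coset that contains [H :* x] contains [x], so it can be written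
    [K :* x] with the same representative, and then [H] is contained in [K]. *)
Lemma coset_above H x D : x \in G -> (D \in C) && ((H :* x)%g < D)%O =
  (D \in [set (K :* x)%g | K : {group gT} in [set K in p_subgroups | H \proper K]]%SET).
Proof.
move=> xG; apply/andP/imsetP => [[/coset_posetP[K [y [KP yG ->]]]]|[K]].
  rewrite setlt_proper => /andP[HK KH]; exists K; last first.
    have /rcoset_eqP-> // : x \in (K :* y)%g by rewrite (fintype.subsetP HK) ?rcoset_refl.
  have e : (K :* y = K :* x)%g.
    by apply/esym/rcoset_eqP; rewrite (fintype.subsetP HK) ?rcoset_refl.
  by rewrite e !rcosetS in HK KH; rewrite inE KP properE HK.
rewrite inE => /andP[KP HK] ->; split; first by apply/coset_posetP; exists K, x.
by rewrite setlt_proper properE !rcosetS -properE.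
Qed.

Lemma sum_coset_above (F : {set gT} -> int) H x : x \in G ->
  \sum_(D in C | ((H :* x)%g < D)%O) F D =
  \sum_(K in p_subgroups | H \proper K) F (K :* x)%g.
Proof.
move=> xG; rewrite (eq_bigl _ _ (fun D => coset_above H D xG)) big_imset /=.
  by apply: eq_bigl => K; rewrite inE.
move=> K L _ _ /(congr1 (fun D => D :* x^-1)%g).
by rewrite !rcosetK => /val_inj.
Qed.

Lemma subgroup_posetP D :
  reflect (D = G \/ exists2 H, H \in p_subgroups & D = H) (D \in subgroup_poset p G).
Proof.
apply: (iffP imsetP) => [[H + ->]|].
  rewrite finset.in_setU finset.in_set2 -orbA => /or3P[/eqP->|/eqP->|HP].
  - by right; exists 1%G => //; rewrite p_subgroupsP sub1G pgroup1.
  - by left.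
  - by right; exists H => //; rewrite finset.in_setU HP orbT.
case=> [->|[H HP ->]].
  by exists G => //; rewrite finset.in_setU finset.in_set2 eqxx orbT.
exists H => //; move: HP; rewrite !finset.in_setU !finset.in_set1.
by case/orP => ->; rewrite ?orbT.
Qed.

(** The defining equation of the Möbius function on the interval from [H] to
    [G]; since [G] is not a p-group, it is the only element of the poset
    outside the p-subgroups, and it contributes 1. *)
Lemma moebius_p_subgroup H : ~~ (p.-group G)%g -> H \in p_subgroups ->
  - moebius (subgroup_poset p G) H G =
  1 - \sum_(K in p_subgroups | H \proper K) (- moebius (subgroup_poset p G) K G).
Proof.
move=> nG HP; set P := subgroup_poset p G; set mu := moebius P.
have GP : (G : {set gT}) \in P by apply/subgroup_posetP; left.
have sub_P K : K \in p_subgroups -> (K : {set gT}) \in P.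
  by move=> KP; apply/subgroup_posetP; right; exists K.
have pG K : K \in p_subgroups -> (K : {set gT}) != G.
  by rewrite p_subgroupsP => /andP[_ pK]; apply: contraNneq nG => <-.
have sG K : K \in p_subgroups -> K \subset G by rewrite p_subgroupsP => /andP[].
have muG : mu G G = 1 by rewrite /mu moebiusE // eqxx.
have [|_] := @moebiusP _ _ P H G (sub_P _ HP) GP; first by rewrite setle_subset sG.
rewrite (negbTE (pG _ HP)) -/mu (bigD1 (G : {set gT})) /=; last first.
  by rewrite GP !setle_subset sG /=.
rewrite muG (bigD1 (H : {set gT})) /=; last first.
  by rewrite sub_P // !setle_subset subxx sG // pG.
rewrite sumrN opprK => e.
have eI D : [&& D \in P, ((H : {set gT}) <= D <= G)%O, D != G & D != H] =
    (D \in [set (K : {set gT}) | K : {group gT} in [set K in p_subgroups | H \proper K]]%SET).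
  apply/idP/imsetP => [/and4P[/subgroup_posetP[->|[K KP ->]]]|[K]]; first by rewrite eqxx.
    rewrite !setle_subset => /andP[HK _] _ KH; exists K => //.
    by rewrite inE KP finset.properEneq eq_sym KH HK.
  rewrite inE finset.properEneq => /andP[KP /andP[HK sHK]] ->.
  by rewrite sub_P // !setle_subset sHK sG // pG //= eq_sym.
have muK : \sum_(K in p_subgroups | H \proper K) mu K G =
    \sum_(D | [&& D \in P, ((H : {set gT}) <= D <= G)%O, D != G & D != H]) mu D G.
  rewrite (eq_bigl _ _ eI) big_imset /=; last by move=> K L _ _ /val_inj.
  by apply: eq_bigl => K; rewrite [RHS]inE.
rewrite muK; apply/eqP; rewrite eq_sym -addr_eq0; apply/eqP.
rewrite -[RHS]e -addrA [X in _ + X]addrC; congr (_ + (_ + _)).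
by apply: eq_bigl => D; rewrite -!andbA.
Qed.

(** Both sides satisfy the same recursion over the p-subgroups above [H]. *)
Lemma altsum_above_coset H x : ~~ (p.-group G)%g -> H \in p_subgroups -> x \in G ->
  altsum (above C (H :* x)%g) = - moebius (subgroup_poset p G) H G.
Proof.
move=> nG + xG; move: {2}(#|G| - #|H|)%N (leqnn (#|G| - #|H|)) => n.
elim: n H => [|n IH] H Hn HP.
  have : (G : {set gT}) \subset H.
    have HG : H \subset G by move: HP; rewrite p_subgroupsP => /andP[].
    have /eqP-> // : (H : {set gT}) == G.
    by rewrite eqEcard HG -subn_eq0 -leqn0.
  move: HP; rewrite p_subgroupsP => /andP[_ pH] /pgroupS/(_ pH) pG.
  by rewrite pG in nG.
rewrite altsum_above_rec sum_coset_above // moebius_p_subgroup //.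
congr (1 - _); apply: eq_bigr => K /andP[KP HK]; apply: IH => //.
have KG : (#|K| <= #|G|)%N by apply: subset_leq_card; move: KP; rewrite p_subgroupsP => /andP[].
by rewrite -ltnS (leq_trans _ Hn) // ltn_sub2l // (leq_trans (proper_card HK)).
Qed.

(** Each coset [D] determines its subgroup, so the sum over cosets splits
    according to [H] into sums over [rcosets H G]. *)
Lemma euler_char_coset_poset : ~~ (p.-group G)%g ->
  euler_char C = - \sum_(H in p_subgroups) moebius (subgroup_poset p G) H G * #|G : H|%g%:Z.
Proof.
move=> nG; rewrite euler_char_above -sumrN.
transitivity (\sum_(D in C) \sum_(H in p_subgroups | D \in rcosets H G) altsum (above C D)).
  apply: eq_bigr => D /coset_posetP[H [x [HP xG ->]]].
  rewrite (big_pred1 H) // => K; apply/andP/eqP => [[KP /rcosetsP[y yG e]]|->]; last first.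
    by split => //; apply/rcosetsP; exists x.
  apply/val_inj => /=.
  have xe : x \in (K :* y)%g by rewrite -e rcoset_refl.
  move/rcoset_eqP: xe => xe; rewrite -xe in e.
  by rewrite -(rcosetK x H) e rcosetK.
rewrite (exchange_big_dep (mem p_subgroups)) /=; last by move=> D H _ /andP[].
apply: eq_bigr => H HP.
transitivity (\sum_(D in rcosets H G) - moebius (subgroup_poset p G) H G).
  apply: congr_big => // [D|D /and3P[_ _ /rcosetsP[x xG ->]]]; last first.
    exact: altsum_above_coset.
  rewrite HP /=; apply/andP/idP => [[]//|DH]; split => //.
  by case/rcosetsP: DH => x xG ->; apply/coset_posetP; exists H, x.
by rewrite sumr_const -mulNr -mulr_natr natz.
Qed.

Lemma coset_translate D a : a \in G -> D \in C -> (D :* a)%g \in C.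
Proof.
move=> aG /coset_posetP[H [x [HP xG ->]]]; apply/coset_posetP.
by exists H, (x * a)%g; rewrite rcosetM groupM.
Qed.

(** If [g] fixes [H :* x], its conjugate by the inverse of [x] lies in the
    p-group [H], so the order of [g] is a power of [p]. *)
Lemma coset_stab q g D : prime q -> q != p -> #[g]%g = q -> D \in C -> (D :* g)%g != D.
Proof.
move=> q_pr qp gq /coset_posetP[H [x [HP xG ->]]].
apply/negP => /eqP e; pose z := (g ^ x^-1)%g.
have zH : z \in H.
  have : (x * g)%g \in (H :* x)%g by rewrite -e -rcosetM rcoset_refl.
  by rewrite mem_rcoset /z /conjg invgK mulgA.
move: HP; rewrite p_subgroupsP => /andP[_ pH].
have := mem_p_elt pH zH; rewrite /p_elt orderJ gq pnatE // inE /=.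
by rewrite (negbTE qp).
Qed.

Let translate := ('Rs^*)%act : {action gT &-> {set {set gT}}}.

Lemma translateE c a : translate c a = [set (D :* a)%g | D in c]%SET.
Proof. by apply: eq_imset => D; rewrite /= rcosetE. Qed.

Lemma translate_chain k c a : a \in G -> c \in chains C k -> translate c a \in chains C k.
Proof.
move=> aG; rewrite inE => /andP[/order_complexP[cC cc] ck].
rewrite inE card_setact ck andbT translateE; apply/order_complexP; split.
  by apply/fintype.subsetP => _ /imsetP[D Dc ->]; rewrite coset_translate ?(fintype.subsetP cC).
move=> _ _ /imsetP[D Dc ->] /imsetP[E Ec ->].
by rewrite /Order.comparable !setle_subset !rcosetS; exact: cc.
Qed.

(** An element [g] of order [q] fixes no nonempty chain: [D] and [D :* g] would be
    comparable members of the chain with the same cardinal, hence equal. *)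
Lemma chains_dvd q k : prime q -> q != p -> (q %| #|G|)%N ->
  (q %| #|chains C k.+1|)%N.
Proof.
move=> q_pr qp qG; have [g gG gq] := Cauchy q_pr qG.
have gsG : <[g]>%g \subset G by rewrite cycle_subG.
have acts : [acts <[g]>%g, on chains C k.+1 | translate].
  apply/actsP => a /(fintype.subsetP gsG) aG c; apply/idP/idP => ck.
    by rewrite -(actK translate a c) translate_chain // groupV.
  exact: translate_chain.
have qg : (q.-group <[g]>)%g by rewrite /pgroup -orderE gq pnat_id.
have := pgroup_fix_mod qg acts.
have -> : ('Fix_(chains C k.+1 | translate)(<[g]>))%g = finset.set0; last first.
  by rewrite cards0 mod0n => /eqP.
apply/setP => c; rewrite finset.in_setI finset.in_set0; apply/negP => /andP[+ /afixP cfix].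
rewrite inE => /andP[cC /eqP ck].
have [D Dc] : exists D, D \in c by apply/set0Pn; rewrite -card_gt0 ck.
have Dgc : (D :* g)%g \in c.
  by rewrite -(cfix g (cycle_id g)) translateE; apply/imsetP; exists D.
have [cC' cc] := order_complexP _ _ cC.
have /negP[] := coset_stab q_pr qp gq (fintype.subsetP cC' _ Dc).
have := cc _ _ Dc Dgc; rewrite /Order.comparable !setle_subset => /orP[] h.
  by rewrite eq_sym eqEcard h card_rcoset leqnn.
by rewrite eqEcard h card_rcoset leqnn.
Qed.

Lemma euler_char_pgroup : prime p -> euler_char C = 1 -> (p.-group G)%g.
Proof.
move=> p_pr chi1; apply/pgroupP => q q_pr qG; rewrite inE; apply: contraT => qp.
have : (q%:Z %| euler_char C)%Z.
  apply: rpred_sum => i _; rewrite -mulr_natr; apply: dvdz_mull.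
  by rewrite natz; exact: chains_dvd.
by rewrite chi1 dvdz1 absz_nat => /eqP q1; rewrite q1 in q_pr.
Qed.

End CosetPoset.

Theorem theorem1 (R : realType) (gT : finGroupType) (G : {group gT}) (p : nat)
    (hp : prime p) :
  euler_char (coset_poset p G) =
    (if (p.-group G)%g then 1
     else - \sum_(H in (1%G |: nontrivial_p_subgroups p G)%SET)
              moebius (subgroup_poset p G) H G * #|G : H|%g%:Z) /\
  [<-> (p.-group G)%g;
       contractible R (realization R (coset_poset p G));
       Z_acyclic (coset_poset p G);
       euler_char (coset_poset p G) = 1].
Proof.
have contr : (p.-group G)%g -> contractible R (realization R (coset_poset p G)).
  move=> pG; apply: (@top_contractible _ _ R _ (G : {set gT})).
    apply/coset_posetP; exists G, 1%g.
    by rewrite p_subgroupsP subxx pG group1 rcoset1.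
  move=> D /coset_posetP[H [x [HP xG ->]]].
  move: HP; rewrite p_subgroupsP => /andP[HG _].
  by rewrite setle_subset -(rcoset_id xG) rcosetS.
have acyc := @contractible_acyclic _ _ R (coset_poset p G).
have chi1 := @acyclic_euler_char _ _ (coset_poset p G).
split; last by tfae => //; exact: euler_char_pgroup.
case: ifPn => [pG|nG]; first exact/chi1/acyc/contr.
exact: euler_char_coset_poset.
Qed.
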